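(* Let $X$ be a compact Hausdorff space and let $\mathscr{H}$ be a separable Hilbert space. If the group of all order automorphisms of the $C^*$-algebra $C(X)$ is algebraically reflexive, then the group of all order automorphisms of the $C^*$-algebra $C(X)\otimes \mathscr{B}(\mathscr{H})$ is also algebraically reflexive.
   Context: All spaces are over $\mathbb{C}$. $C(X)$ is the $C^*$-algebra of all continuous complex-valued functions on $X$, and $\mathscr{B}(\mathscr{H})$ is the $C^*$-algebra of all bounded linear operators on $\mathscr{H}$. The tensor product $C(X)\otimes\mathscr{B}(\mathscr{H})$ is taken in the $C^*$-algebra sense; it is identified, via an isometric isomorphism, with the $C^*$-algebra $C(X,\mathscr{B}(\mathscr{H}))$ of all (norm-)continuous functions from $X$ into $\mathscr{B}(\mathscr{H})$ with pointwise operations and the sup norm. Order automorphism: for a $C^*$-algebra $\mathscr{A}$, a linear bijection $\phi:\mathscr{A}\to\mathscr{A}$ is called an order automorphism of $\mathscr{A}$ if for every $a\in\mathscr{A}$, $\phi(a)$ is positive if and only if $a$ is positive. Algebraic reflexivity: for a Banach space $\mathscr{X}$ (with $\mathscr{B}(\mathscr{X})$ the bounded linear operators on $\mathscr{X}$) and a subset $\mathscr{E}\subset\mathscr{B}(\mathscr{X})$, put $\operatorname{ref}_{al}\mathscr{E}=\{T\in\mathscr{B}(\mathscr{X}) : Tx\in\mathscr{E}x \text{ for all } x\in\mathscr{X}\}$, where $\mathscr{E}x=\{Sx: S\in\mathscr{E}\}$. The set $\mathscr{E}$ is called algebraically reflexive if $\operatorname{ref}_{al}\mathscr{E}=\mathscr{E}$.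 *)

(* Defs.v *)
From HB Require Import structures.
From mathcomp Require Import all_boot all_order all_algebra.
From mathcomp Require Import sesquilinear lra ring.
From mathcomp Require Import all_classical all_reals all_analysis.

Set Implicit Arguments.
Unset Strict Implicit.
Unset Printing Implicit Defensive.

Import Order.TTheory GRing.Theory Num.Theory.
Import numFieldNormedType.Exports.
(* imported last so that [Re] and [Im] are the projections [R[i] -> R] *)
From mathcomp Require Import complex.

Local Open Scope classical_set_scope.
Local Open Scope ring_scope.

(* The scalar field is C = R[i] for R : realType. Norms of C-normed modules
   are R[i]-valued; in R[i], x <= y means that y - x is a nonnegative real. *)

HB.instance Definition _ (R : realType) := NormedModule.copy R[i] R[i]^o.

Section ComplexComplete.
Variable R : realType.

Lemma normv_Re (V : normedModType R[i]) (v : V) : (Re (`|v| : R[i]))%:C%C = `|v| :> R[i].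
Proof. by rewrite RRe_real // normr_real. Qed.

Lemma normC_Re_le (z : R[i]) : (`|Re z|%:C)%C <= `|z|.
Proof. exact: normc_ge_Re. Qed.

Lemma normC_Im_le (z : R[i]) : (`|Im z|%:C)%C <= `|z|.
Proof.
by case: z => a b; rewrite normc_def lecR /= -sqrtr_sqr ler_wsqrtr // lerDr sqr_ge0.
Qed.

Lemma normC_le_ReIm (z : R[i]) : `|z| <= (`|Re z| + `|Im z|)%:C%C.
Proof.
rewrite normc_def lecR /= -[leRHS]ger0_norm ?addr_ge0 // -sqrtr_sqr ler_wsqrtr //.
by rewrite sqrrD !real_normK ?num_real // -addrA lerD2l lerDr mulrn_wge0 // mulr_ge0.
Qed.

Lemma complex_cauchy_cvg (F : set_system R[i]) :
  ProperFilter F -> cauchy F -> cvg F.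
Proof.
move=> FF /cauchy_ballP Fc.
have cRe : cvg (@Re R @ F).
  apply/cauchy_cvgP/cauchy_ballP => e e0.
  rewrite near_map2.
  apply: (filterS _ (Fc e%:C%C _)); last by rewrite ltcR.
  case=> x y; rewrite -[ball _ _ _]/(_ (_ < _)) => xy /=.
  rewrite -[ball _ _ _]/(_ (_ < _)) -raddfB /= -ltcR.
  exact: le_lt_trans (normC_Re_le (x - y)) xy.
have cIm : cvg (@Im R @ F).
  apply/cauchy_cvgP/cauchy_ballP => e e0.
  rewrite near_map2.
  apply: (filterS _ (Fc e%:C%C _)); last by rewrite ltcR.
  case=> x y; rewrite -[ball _ _ _]/(_ (_ < _)) => xy /=.
  rewrite -[ball _ _ _]/(_ (_ < _)) -raddfB /= -ltcR.
  exact: le_lt_trans (normC_Im_le (x - y)) xy.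
apply/cvg_ex; exists (Complex (lim (@Re R @ F)) (lim (@Im R @ F))).
apply/cvgrPdist_lt => e e0.
have eE : (Re e)%:C%C = e by rewrite RRe_real // gtr0_real.
have e20 : 0 < Re e / 2 by rewrite divr_gt0 // -ltcR eE.
near=> z; apply: le_lt_trans (normC_le_ReIm _) _.
rewrite -eE ltcR [ltRHS]splitr ltrD //.
- by rewrite raddfB /=; near: z; apply: cvgr_dist_lt.
- by rewrite raddfB /=; near: z; apply: cvgr_dist_lt.
Unshelve. all: by end_near. Qed.

End ComplexComplete.

HB.instance Definition _ (R : realType) :=
  Uniform_isComplete.Build R[i] (@complex_cauchy_cvg R).

(* C*-algebras, with or without unit: the zero algebra is included, so that
   C(X) for empty X and B(H) for H = 0 are instances. The product is not that of
   [pzRingType] because a structure joining rings and normed modules cannot be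
   declared above [numDomainType] in MathComp's hierarchy. *)
HB.mixin Record isCStar (R : realType) A of CompleteNormedModule R[i] A := {
  cmul : A -> A -> A;
  star : A -> A;
  cmulA : associative cmul;
  cmulDl : left_distributive cmul +%R;
  cmulDr : right_distributive cmul +%R;
  cmulZl : forall (l : R[i]) (a b : A), cmul (l *: a) b = l *: cmul a b;
  cmulZr : forall (l : R[i]) (a b : A), cmul a (l *: b) = l *: cmul a b;
  normr_cmul : forall a b : A, `|cmul a b| <= `|a| * `|b|;
  starK : involutive star;
  starD : {morph star : a b / a + b};
  starZ : forall (l : R[i]) (a : A), star (l *: a) = l^* *: star a;
  starM : forall a b : A, star (cmul a b) = cmul (star b) (star a);
  normr_star_cmul : forall a : A, `|cmul (star a) a| = `|a| ^+ 2
}.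
#[short(type="cstarType")]
HB.structure Definition CStar (R : realType) :=
  {A of CompleteNormedModule R[i] A & isCStar R A}.

Section ComplexCStar.
Variable R : realType.
Implicit Types l a b : R[i].

Let normM a b : `|a * b| <= `|a| * `|b|. Proof. by rewrite normrM. Qed.

Let cmulZl l a b : (l *: a) * b = l *: (a * b).
Proof. by rewrite /GRing.scale /= mulrA. Qed.

Let cmulZr l a b : a * (l *: b) = l *: (a * b).
Proof. by rewrite /GRing.scale /= mulrCA. Qed.

Let conjM a b : (a * b)^* = b^* * a^*.
Proof. by rewrite rmorphM mulrC. Qed.

Let norm_conjM a : `|a^* * a| = `|a| ^+ 2.
Proof. by rewrite mulrC -normCK normrX normr_id. Qed.

HB.instance Definition _ := @isCStar.Build R R[i] *%R Num.conj
  (@mulrA _) (@mulrDl _) (@mulrDr _) cmulZl cmulZr normM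
  (@conjCK _) (rmorphD Num.conj) (rmorphM Num.conj) conjM norm_conjM.

End ComplexCStar.

(* The inner product is linear in its first argument. *)
HB.mixin Record isHilbert (R : realType) H of CompleteNormedModule R[i] H := {
  hdot : {dot H for Num.conj};
  hdot_norm : forall x : H, `|x| ^+ 2 = hdot x x
}.
#[short(type="hilbertType")]
HB.structure Definition Hilbert (R : realType) :=
  {H of CompleteNormedModule R[i] H & isHilbert R H}.

HB.mixin Record isCompactHausdorff X of Topological X := {
  compactT : compact [set: X];
  hausdorffT : hausdorff_space X
}.
#[short(type="compactHausdorffType")]
HB.structure Definition CompactHausdorff :=
  {X of Topological X & isCompactHausdorff X}.

Section SupNorm.
Variables (R : realType) (T : Type) (V : normedModType R[i]) (D : set T).
Implicit Types (f g : T -> V) (M : R[i]).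

Definition bounded_on f := exists M : R[i], forall t, D t -> `|f t| <= M.

(* The supremum is taken in R, where [sup set0 = 0]. *)
Definition supnorm f : R[i] := (sup [set Re (`|f t| : R[i]) | t in D])%:C%C.

Let S f := [set Re (`|f t| : R[i]) | t in D].

Let Re_le (x y : R[i]) : x <= y -> Re x <= Re y.
Proof. by rewrite lecE => /andP[]. Qed.

Lemma supnorm_ub f t : bounded_on f -> D t -> `|f t| <= supnorm f.
Proof.
move=> [M fM] Dt; rewrite -normv_Re lecR; apply: sup_upper_bound.
  split; first by exists (Re (`|f t| : R[i])), t.
  by exists (Re M) => _ [u Du <-]; apply/Re_le/fM.
by exists t.
Qed.

Lemma supnorm_ge0 f : 0 <= supnorm f.
Proof.
rewrite ler0c -/(S f); have [S0|] := pselect (has_sup (S f)); last by move=> /sup_out ->.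
have [[_ [t Dt _]] _] := S0.
apply: (@le_trans _ _ (Re (`|f t| : R[i]))).
  by rewrite -(raddf0 (@Re R)) Re_le.
by apply: sup_upper_bound => //; exists t.
Qed.

Lemma supnorm_le f M : 0 <= M -> (forall t, D t -> `|f t| <= M) ->
  supnorm f <= M.
Proof.
move=> M0 fM; have ME : (Re M)%:C%C = M by rewrite RRe_real // ger0_real.
rewrite -ME lecR -/(S f); have [->|/set0P S0] := eqVneq (S f) set0.
  by rewrite sup0 -ler0c ME.
by apply: ge_sup => // _ [t Dt <-]; apply/Re_le/fM.
Qed.

Lemma supnormD f g : bounded_on f -> bounded_on g ->
  supnorm (fun t => f t + g t) <= supnorm f + supnorm g.
Proof.
move=> bf bg; apply: supnorm_le => [|t Dt]; first by rewrite addr_ge0 ?supnorm_ge0.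
by rewrite (le_trans (ler_normD _ _)) // lerD // supnorm_ub.
Qed.

Lemma supnormZ (l : R[i]) f : bounded_on f ->
  supnorm (fun t => l *: f t) = `|l| * supnorm f.
Proof.
move=> bf; apply/eqP; rewrite eq_le; apply/andP; split.
  apply: supnorm_le => [|t Dt]; first by rewrite mulr_ge0 ?supnorm_ge0.
  by rewrite normrZ ler_wpM2l // supnorm_ub.
have [->|l0] := eqVneq l 0; first by rewrite normr0 mul0r supnorm_ge0.
have bl : bounded_on (fun t => l *: f t).
  have [M fM] := bf; exists (`|l| * M) => t Dt.
  by rewrite normrZ ler_wpM2l // fM.
rewrite mulrC -ler_pdivlMr ?normr_gt0 //; apply: supnorm_le => [|t Dt].
  by rewrite divr_ge0 ?supnorm_ge0.
by rewrite ler_pdivlMr ?normr_gt0 // mulrC -normrZ; apply: (supnorm_ub bl).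
Qed.

Lemma supnorm_eq0 f : bounded_on f -> supnorm f = 0 -> forall t, D t -> f t = 0.
Proof.
move=> bf f0 t Dt; apply/eqP; rewrite -normr_eq0 eq_le normr_ge0 andbT -f0.
exact: supnorm_ub.
Qed.

End SupNorm.

Section CXA.
Variables (R : realType) (X : compactHausdorffType) (A : normedModType R[i]).

(* C(X, A) for a compact Hausdorff space X; C(X) is [cont_space X R[i]], and
   [cont_space X (boundedop H)] is C(X) (x) B(H), by the isometric isomorphism
   C(X) (x) B(H) = C(X, B(H)). *)
Definition cont_space : Type := continuousType X A.
HB.instance Definition _ := Choice.on cont_space.

Definition cont_fun (f : cont_space) : X -> A := f.
Coercion cont_fun : cont_space >-> Funclass.

Definition mkcont (f : X -> A) (cf : continuous f) : cont_space :=
  (mkcts cf : continuousType X A).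

Implicit Types f g h : cont_space.

Lemma mkcontE (f : X -> A) (cf : continuous f) x : mkcont cf x = f x.
Proof. by []. Qed.

Lemma contP f g : (forall x, f x = g x) -> f = g.
Proof. by move=> fg; apply/continuousEP. Qed.

Lemma cont_continuous f : continuous f.
Proof. exact: (@cts_fun X A f). Qed.

Let addf_cont f g : continuous (fun x => f x + g x).
Proof. by move=> x; apply: cvgD; apply: cont_continuous. Qed.

Let oppf_cont f : continuous (fun x => - f x).
Proof. by move=> x; apply: cvgN; apply: cont_continuous. Qed.

Let scalef_cont (l : R[i]) f : continuous (fun x => l *: f x).
Proof. by move=> x; apply: cvgZr; apply: cont_continuous. Qed.

Let zerof := mkcont (fun x => cvg_cst (0 : A) : (fun=> 0) @ x --> 0).
Let addf f g := mkcont (@addf_cont f g).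
Let oppf f := mkcont (@oppf_cont f).
Let scalef l f := mkcont (@scalef_cont l f).

Let addfA : associative addf.
Proof. by move=> f g h; apply: contP => x; rewrite !mkcontE addrA. Qed.
Let addfC : commutative addf.
Proof. by move=> f g; apply: contP => x; rewrite !mkcontE addrC. Qed.
Let add0f : left_id zerof addf.
Proof. by move=> f; apply: contP => x; rewrite !mkcontE add0r. Qed.
Let addNf : left_inverse zerof oppf addf.
Proof. by move=> f; apply: contP => x; rewrite !mkcontE addNr. Qed.

HB.instance Definition _ :=
  GRing.isZmodule.Build cont_space addfA addfC add0f addNf.

Let scalefA l m f : scalef l (scalef m f) = scalef (l * m) f.
Proof. by apply: contP => x; rewrite !mkcontE scalerA. Qed.
Let scale1f : left_id 1 scalef.
Proof. by move=> f; apply: contP => x; rewrite !mkcontE scale1r. Qed.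
Let scalefDr : right_distributive scalef +%R.
Proof. by move=> l f g; apply: contP => x; rewrite !mkcontE scalerDr. Qed.
Let scalefDl f : {morph scalef^~ f : l m / l + m}.
Proof. by move=> l m; apply: contP => x; rewrite !mkcontE scalerDl. Qed.

HB.instance Definition _ := GRing.Zmodule_isLmodule.Build R[i] cont_space
  scalefA scale1f scalefDr scalefDl.

Lemma contDE f g x : (f + g) x = f x + g x. Proof. by []. Qed.
Lemma contNE f x : (- f) x = - f x. Proof. by []. Qed.
Lemma contZE (l : R[i]) f x : (l *: f) x = l *: f x. Proof. by []. Qed.
Lemma cont0E x : (0 : cont_space) x = 0. Proof. by []. Qed.

Lemma cont_bounded f : bounded_on [set: X] f.
Proof.
have /compact_near_coveringP/(_ R +oo_R (fun M x => `|f x| <= M%:C%C)) := @compactT X.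
case=> [x _|M [_ /(_ (M + 1))]].
  near=> y M => /=; apply: (@le_trans _ _ (`|f x| + 1)).
    rewrite -lerBlDl (le_trans (lerB_dist _ _)) // ltW // distrC.
    by near: y; apply: cvgr_dist_lt => //; exact: cont_continuous.
  by rewrite -normv_Re -raddfD lecR; near: M; apply: nbhs_pinfty_ge; rewrite num_real.
by move=> fM; exists (M + 1)%:C%C => x Dx; apply: fM; rewrite ?ltrDl.
Unshelve. all: by end_near. Qed.

Lemma cont_add_subproof f g : supnorm [set: X] (f + g) <=
  supnorm [set: X] f + supnorm [set: X] g.
Proof. by apply: supnormD; apply: cont_bounded. Qed.

Lemma cont_scale_subproof (l : R[i]) f :
  supnorm [set: X] (l *: f) = `|l| * supnorm [set: X] f.
Proof. by apply: supnormZ; apply: cont_bounded. Qed.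

Lemma cont_eq0_subproof f : supnorm [set: X] f = 0 -> f = 0.
Proof.
move=> f0; apply: contP => x.
by rewrite (supnorm_eq0 (cont_bounded f) f0).
Qed.

HB.instance Definition _ := Lmodule_isNormed.Build R[i] cont_space
  cont_add_subproof cont_scale_subproof cont_eq0_subproof.

Lemma contnormE f : `|f| = supnorm [set: X] f. Proof. by []. Qed.

Lemma contnorm_ub f x : `|f x| <= `|f|.
Proof. exact: supnorm_ub (cont_bounded f) _. Qed.

Lemma contnorm_le f (M : R[i]) : 0 <= M -> (forall x, `|f x| <= M) -> `|f| <= M.
Proof. by move=> M0 fM; apply: supnorm_le. Qed.

End CXA.

Section CXAComplete.
Variables (R : realType) (X : compactHausdorffType).
Variable A : completeNormedModType R[i].
Local Notation CXA := (cont_space X A).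

Lemma cont_cauchy_cvg (F : set_system CXA) :
  ProperFilter F -> cauchy F -> cvg F.
Proof.
move=> FF /cauchy_ballP Fc.
have Fx x : cvg ((fun f : CXA => f x) @ F).
  apply/cauchy_cvgP/cauchy_ballP => e e0; rewrite near_map2.
  apply: filterS (Fc e e0) => -[f g] /=.
  rewrite -!ball_normE /= => fg; apply: le_lt_trans fg.
  by rewrite -contNE -contDE contnorm_ub.
pose l x := lim ((fun f : CXA => f x) @ F).
have Fl e : 0 < e -> \forall f \near F, forall x, `|l x - (f : CXA) x| <= e.
  move=> e0; have e20 : 0 < e / 2 by rewrite divr_gt0.
  near=> f => x; near F => g.
  rewrite -(subrK (g x) (l x)) -addrA (le_trans (ler_normD _ _)) //.
  rewrite [leRHS]splitr lerD //.
    by rewrite ltW //; near: g; apply: cvgr_dist_lt.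
  rewrite -contNE -contDE (le_trans (contnorm_ub _ _)) // ltW // distrC.
  have : ball f (e / 2) g.
    near: g; near: f; apply: nearP_dep; exact: Fc.
  by rewrite -ball_normE.
have lc : continuous l.
  move=> x; apply/cvgrPdist_lt => e e0.
  have e30 : 0 < e / 3 by rewrite divr_gt0.
  near F => f; near=> y.
  have lf z : `|l z - f z| <= e / 3 by move: z; near: f; apply: Fl.
  have -> : l x - l y = (l x - f x) + (f x - f y) - (l y - f y).
    by rewrite opprB !addrA !subrK.
  rewrite (le_lt_trans (ler_normB _ _)) //.
  rewrite (le_lt_trans (lerD (ler_normD _ _) (lexx _))) //.
  have -> : e = e / 3 + e / 3 + e / 3.
    by rewrite -mulr2n -mulrSr -[RHS]mulr_natr divfK ?pnatr_eq0.
  rewrite ltr_leD // ler_ltD //.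
  by near: y; apply: cvgr_dist_lt => //; exact: cont_continuous.
apply/cvg_ex; exists (mkcont lc : CXA); apply/cvgrPdist_le => e e0.
near=> f; suff fl x : `|l x - (f : CXA) x| <= e.
  by apply: contnorm_le; [exact: ltW | exact: fl].
by move: x; near: f; apply: Fl.
Unshelve. all: by end_near. Qed.

HB.instance Definition _ :=
  Uniform_isComplete.Build CXA cont_cauchy_cvg.

End CXAComplete.

Section CXACStar.
Variables (R : realType) (X : compactHausdorffType) (A : cstarType R).
Local Notation CXA := (cont_space X A).
Implicit Types f g h : CXA.

Lemma cmulBl (a b c : A) : cmul (a - b) c = cmul a c - cmul b c.
Proof. by rewrite cmulDl -scaleN1r cmulZl scaleN1r. Qed.

Lemma cmulBr (a b c : A) : cmul a (b - c) = cmul a b - cmul a c.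
Proof. by rewrite cmulDr -scaleN1r cmulZr scaleN1r. Qed.

Lemma starB (a b : A) : star (a - b) = star a - star b.
Proof. by rewrite starD -scaleN1r starZ rmorphN rmorph1 scaleN1r. Qed.

Lemma norm_star_le (a : A) : `|a| <= `|star a|.
Proof.
have [->|a0] := eqVneq a 0; first by rewrite normr0.
rewrite -(@ler_pM2r _ `|a|) ?normr_gt0 // -expr2 -normr_star_cmul.
exact: normr_cmul.
Qed.

Lemma norm_star (a : A) : `|star a| = `|a|.
Proof.
by apply/eqP; rewrite eq_le norm_star_le -{2}(starK a) norm_star_le.
Qed.

Let mul_cont f g : continuous (fun x => cmul (f x) (g x)).
Proof.
move=> x; apply/cvgrPdist_lt => e e0.
pose M := `|f| + `|g| + 1.
have M0 : 0 < M by rewrite ltr_wpDl ?addr_ge0.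
have d0 : 0 < e / 2 / M by rewrite !divr_gt0.
near=> y.
have -> : cmul (f x) (g x) - cmul (f y) (g y) =
    cmul (f x) (g x - g y) + cmul (f x - f y) (g y).
  by rewrite cmulBl cmulBr addrA subrK.
rewrite (le_lt_trans (ler_normD _ _)) // [ltRHS]splitr.
have fM z : `|f z| <= M.
  by rewrite (le_trans (contnorm_ub _ _)) // /M -addrA lerDl addr_ge0.
have gM z : `|g z| <= M.
  by rewrite (le_trans (contnorm_ub _ _)) // /M -addrA addrCA lerDl addr_ge0.
rewrite ltrD // (le_lt_trans (normr_cmul _ _)) //.
- rewrite (le_lt_trans (ler_wpM2r _ (fM x))) // mulrC -ltr_pdivlMr //.
  by near: y; apply: cvgr_dist_lt => //; exact: cont_continuous.
- rewrite (le_lt_trans (ler_wpM2l _ (gM y))) // -ltr_pdivlMr //.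
  by near: y; apply: cvgr_dist_lt => //; exact: cont_continuous.
Unshelve. all: by end_near. Qed.

Let star_cont f : continuous (fun x => star (f x)).
Proof.
move=> x; apply/cvgrPdist_lt => e e0; near=> y.
rewrite -starB norm_star.
by near: y; apply: cvgr_dist_lt => //; exact: cont_continuous.
Unshelve. all: by end_near. Qed.

Let mulf f g : CXA := mkcont (@mul_cont f g).
Let starf f : CXA := mkcont (@star_cont f).

Let mulfA : associative mulf.
Proof. by move=> f g h; apply: contP => x; rewrite !mkcontE cmulA. Qed.
Let mulfDl : left_distributive mulf +%R.
Proof. by move=> f g h; apply: contP => x; exact: cmulDl. Qed.
Let mulfDr : right_distributive mulf +%R.
Proof. by move=> f g h; apply: contP => x; exact: cmulDr. Qed.
Let mulfZl (l : R[i]) f g : mulf (l *: f) g = l *: mulf f g.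
Proof. by apply: contP => x; exact: cmulZl. Qed.
Let mulfZr (l : R[i]) f g : mulf f (l *: g) = l *: mulf f g.
Proof. by apply: contP => x; exact: cmulZr. Qed.
Let norm_mulf f g : `|mulf f g| <= `|f| * `|g|.
Proof.
apply: contnorm_le => [|x]; first by rewrite mulr_ge0.
by rewrite mkcontE (le_trans (normr_cmul _ _)) // ler_pM // contnorm_ub.
Qed.
Let starfK : involutive starf.
Proof. by move=> f; apply: contP => x; rewrite !mkcontE starK. Qed.
Let starfD : {morph starf : f g / f + g}.
Proof. by move=> f g; apply: contP => x; exact: starD. Qed.
Let starfZ (l : R[i]) f : starf (l *: f) = l^* *: starf f.
Proof. by apply: contP => x; exact: starZ. Qed.
Let starfM f g : starf (mulf f g) = mulf (starf g) (starf f).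
Proof. by apply: contP => x; rewrite !mkcontE starM. Qed.
Let norm_starf_mulf f : `|mulf (starf f) f| = `|f| ^+ 2.
Proof.
apply/eqP; rewrite eq_le; apply/andP; split.
  apply: contnorm_le => [|x]; first by rewrite exprn_ge0.
  by rewrite mkcontE normr_star_cmul lerXn2r ?nnegrE // contnorm_ub.
have N0 : 0 <= `|mulf (starf f) f| by [].
rewrite -[leRHS]sqrtCK lerXn2r ?nnegrE ?sqrtC_ge0 //.
apply: contnorm_le => [|x]; first by rewrite sqrtC_ge0.
rewrite -(@ler_pXn2r _ 2) ?nnegrE ?sqrtC_ge0 // sqrtCK -normr_star_cmul.
exact: (contnorm_ub (mulf (starf f) f)).
Qed.

HB.instance Definition _ := @isCStar.Build R CXA mulf starf
  mulfA mulfDl mulfDr mulfZl mulfZr norm_mulf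
  starfK starfD starfZ starfM norm_starf_mulf.

Lemma contME f g x : cmul f g x = cmul (f x) (g x). Proof. by []. Qed.
Lemma contstarE f x : star f x = star (f x). Proof. by []. Qed.

End CXACStar.

Section HilbertTheory.
Variables (R : realType) (H : hilbertType R).
Implicit Types (x y z h : H) (l : R[i]).
Local Notation dot := (@hdot R H).

Lemma hdotC x y : dot x y = (dot y x)^*.
Proof. by rewrite hermC expr0 mul1r. Qed.

Lemma hdotDl x y z : dot (x + y) z = dot x z + dot y z.
Proof. exact: linearDl. Qed.

Lemma hdotDr x y z : dot x (y + z) = dot x y + dot x z.
Proof. exact: linearDr. Qed.

Lemma hdotZl l x y : dot (l *: x) y = l * dot x y.
Proof. exact: linearZl_LR. Qed.

Lemma hdotZr l x y : dot x (l *: y) = l^* * dot x y.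
Proof. exact: linearZr_LR. Qed.

Lemma hdotNl x y : dot (- x) y = - dot x y.
Proof. by rewrite -scaleN1r hdotZl mulN1r. Qed.

Lemma hdotNr x y : dot x (- y) = - dot x y.
Proof. by rewrite -scaleN1r hdotZr rmorphN rmorph1 mulN1r. Qed.

Lemma hdot_inj y z : (forall h, dot h y = dot h z) -> y = z.
Proof.
move=> yz; apply/subr0_eq/normr0_eq0/eqP.
suff : `|y - z| ^+ 2 == 0 by rewrite expf_eq0.
by rewrite hdot_norm hdotDr hdotNr yz subrr.
Qed.

Lemma hdot_CS x y : `|dot x y| <= `|x| * `|y|.
Proof.
have [->|y0] := eqVneq y 0.
  by rewrite -(scale0r 0) hdotZr rmorph0 mul0r normr0 mulr_ge0.
have yy0 : 0 < dot y y by rewrite dnorm_gt0.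
rewrite -(@ler_pXn2r _ 2) ?nnegrE ?mulr_ge0 // exprMn !hdot_norm.
have := dnorm_ge0 dot (dot y y *: x - dot x y *: y).
rewrite dnormB !dnormZ hdotZl hdotZr.
have yyR : `|dot y y| = dot y y by rewrite gtr0_norm.
rewrite rmorphM /= [(_^* * _)^*]rmorphM /= conjCK.
rewrite (CrealP (gtr0_real yy0)) yyR [_^* * dot x y]mulrC -normCK.
have -> : dot y y ^+ 2 * dot x x + `|dot x y| ^+ 2 * dot y y -
  (dot y y * `|dot x y| ^+ 2 + dot y y * `|dot x y| ^+ 2)
  = dot y y * (dot x x * dot y y - `|dot x y| ^+ 2) by ring.
by rewrite pmulr_rge0 // subr_ge0.
Qed.

Section Riesz.
Variables (phi : H -> R[i]) (M : R[i]).
Hypotheses (phiD : forall x y, phi (x + y) = phi x + phi y).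
Hypotheses (phiZ : forall l x, phi (l *: x) = l * phi x).
Hypothesis phiM : forall x, `|phi x| <= M * `|x|.

Let n2 x : R := Re (dot x x).
Let b x y : R := Re (dot x y).
Let p x : R := Re (phi x).
Let J x : R := n2 x - 2 * p x.

Let nr x : R := Re (`|x| : R[i]).

Let Re_realM (t : R) (l : R[i]) : Re (t%:C%C * l) = t * Re l.
Proof. by case: l => a c /=; rewrite mul0r subr0. Qed.

Let n2E x : n2 x = nr x ^+ 2.
Proof. by rewrite /n2 -hdot_norm -normv_Re expr2 Re_realM. Qed.

Let n2D x y : n2 (x + y) = n2 x + n2 y + 2 * b x y.
Proof.
rewrite /n2 /b hdotDl !hdotDr [dot y x]hdotC !raddfD /=.
have -> : Re (dot x y)^* = Re (dot x y) by case: (dot x y).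
by ring.
Qed.

Let bZr (t : R) x y : b x (t%:C%C *: y) = t * b x y.
Proof.
have tR : t%:C%C \is Num.real by rewrite complex_real.
by rewrite /b hdotZr (CrealP tR) Re_realM.
Qed.

Let n2Z (t : R) x : n2 (t%:C%C *: x) = t ^+ 2 * n2 x.
Proof.
by rewrite /n2 hdotZl Re_realM; have := bZr t x x; rewrite /b => ->; rewrite mulrA.
Qed.

Let pD x y : p (x + y) = p x + p y.
Proof. by rewrite /p phiD raddfD. Qed.

Let pZ (t : R) x : p (t%:C%C *: x) = t * p x.
Proof. by rewrite /p phiZ Re_realM. Qed.

Let J_ge x : - Re M ^+ 2 <= J x.
Proof.
have : p x <= Re M * nr x.
  have : Re (`|phi x| : R[i]) <= Re (M * `|x|).
    by have := phiM x; rewrite lecE => /andP[].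
  rewrite -[`|x| in leRHS]normv_Re mulrC Re_realM mulrC; apply: le_trans.
  apply: le_trans (ler_norm _) _.
  by have := normC_Re_le (phi x); rewrite lecE => /andP[].
rewrite /J n2E => pM; have := sqr_ge0 (nr x - Re M).
rewrite sqrrB => ?; nra.
Qed.

Let m := inf (range J).

Let J_has_inf : has_inf (range J).
Proof.
split; first by exists (J 0), 0.
by exists (- Re M ^+ 2) => _ [x _ <-]; exact: J_ge.
Qed.

Let m_le x : m <= J x.
Proof. by apply: inf_lbound; [case: J_has_inf | exists x]. Qed.

Let F := filter_from [set e : R | 0 < e] (fun e => [set x | J x <= m + e]).

Let FF : ProperFilter F.
Proof.
have FFilter : Filter F.
  apply: filter_from_filter; first by exists 1; rewrite /= ltr01.
  move=> e d e0 d0; exists (Num.min e d); first by rewrite /= lt_min e0 d0.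
  move=> x /= Jx; split; apply: le_trans Jx _; rewrite lerD2l.
    by rewrite ge_min lexx.
  by rewrite ge_min lexx orbT.
apply: filter_from_proper => e e0; have [_ [x _ <-] Jx] := inf_adherent e0 J_has_inf.
by exists x; exact: ltW.
Qed.

Let F_close e x y : J x <= m + e -> J y <= m + e -> n2 (x - y) <= 4 * e.
Proof.
move=> Jx Jy; have := m_le ((2^-1)%:C%C *: (x + y)).
rewrite /J n2Z pZ pD n2D.
have -> : x - y = x + (-1)%:C%C *: y.
  by rewrite rmorphN rmorph1 scaleN1r.
rewrite n2D n2Z bZr; move: Jx Jy; rewrite /J => Jx Jy mxy.
lra.
Qed.

Let F_cauchy : cauchy F.
Proof.
have PF : ProperFilter F := FF.
apply/cauchy_ballP => e e0.
have eE : (Re e)%:C%C = e by rewrite RRe_real // gtr0_real.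
have Re0 : 0 < Re e by rewrite -ltcR eE.
pose d := Re e ^+ 2 / 16.
have d0 : 0 < d by rewrite divr_gt0 // exprn_gt0.
have Fd : F [set x | J x <= m + d] by exists d.
exists ([set x | J x <= m + d], [set x | J x <= m + d]) => // -[x y] [/= Jx Jy].
rewrite -ball_normE /= -eE -normv_Re ltcR -/(nr _).
rewrite -(@ltr_pXn2r _ 2) ?nnegrE ?(ltW Re0) //; last first.
  by rewrite /nr -ler0c normv_Re.
rewrite -n2E; apply: le_lt_trans (F_close Jx Jy) _.
rewrite /d; have : 0 < Re e ^+ 2 by rewrite exprn_gt0.
by move=> ?; lra.
Qed.

Let y := lim F.

Let F_y : F --> y. Proof. by have PF : ProperFilter F := FF; exact: cauchy_cvg F_cauchy. Qed.

Let riesz_le h : b h y <= p h.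
Proof.
rewrite leNgt; apply/negP => hy.
pose dl := b h y - p h; have dl0 : 0 < dl by rewrite subr_gt0.
have n20 : 0 <= n2 h by rewrite n2E sqr_ge0.
have nh0 : 0 <= nr h by rewrite /nr -ler0c normv_Re.
pose s := dl / (2 * (n2 h + 1)).
have s0 : 0 < s by rewrite divr_gt0 // mulr_gt0 // ltr_wpDl.
have sE : s * (2 * (n2 h + 1)) = dl.
  by rewrite divfK // mulf_neq0 // gt_eqF // ltr_wpDl.
pose e := s * dl / 4; have e0 : 0 < e by rewrite divr_gt0 // mulr_gt0.
pose r := dl / (2 * (nr h + 1)).
have rE : r * (2 * (nr h + 1)) = dl.
  by rewrite divfK // mulf_neq0 // gt_eqF // ltr_wpDl.
have r0 : 0 < r by rewrite divr_gt0 // mulr_gt0 // ltr_wpDl.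
have PF : ProperFilter F := FF.
have [z [Jz yz]] : exists z, J z <= m + e /\ nr (y - z) < r.
  have Fe : F [set x | J x <= m + e] by exists e.
  have Fr : F [set x | nr (y - x) < r].
    have rC0 : 0 < r%:C%C :> R[i] by rewrite ltcR.
    have := F_y (nbhsx_ballx y _ rC0).
    by apply: filterS => x; rewrite -ball_normE /= -normv_Re ltcR.
  by have [z [Jz yz]] := filter_ex (filterI Fe Fr); exists z.
have bz : b h y - b h z <= nr h * nr (y - z).
  have -> : b h y - b h z = Re (dot h (y - z)).
    by rewrite hdotDr hdotNr raddfD raddfN.
  apply: le_trans (ler_norm _) _; rewrite -lecR.
  apply: le_trans (normC_Re_le _) _; apply: le_trans (hdot_CS _ _) _.
  by rewrite -normv_Re -[X in _ * X]normv_Re -rmorphM.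
have := m_le (z + (- s)%:C%C *: h).
rewrite /J n2D n2Z bZr pD pZ.
have -> : b z h = b h z by rewrite /b hdotC; case: (dot h z).
move: Jz; rewrite /J => Jz mz.
have nyz : 0 <= nr (y - z) by rewrite /nr -ler0c normv_Re.
have gz : dl / 2 <= b h z - p h by rewrite /dl in rE *; nra.
have : s * (dl / 2) <= s * (b h z - p h) by rewrite ler_pM2l.
have : s * s * n2 h <= s * (dl / 2).
  by rewrite -mulrA ler_pM2l // -sE; nra.
have : 0 < s * dl by rewrite mulr_gt0.
rewrite /e in Jz; nra.
Qed.

Let riesz_Re h : b h y = p h.
Proof.
apply/eqP; rewrite eq_le riesz_le /=.
have := riesz_le (- h).
have -> : b (- h) y = - b h y by rewrite /b hdotNl raddfN.
have -> : p (- h) = - p h by rewrite -scaleN1r /p phiZ mulN1r raddfN.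
by rewrite lerN2.
Qed.

Lemma riesz : exists y, forall h, phi h = dot h y.
Proof.
exists y => h; have := riesz_Re h; have := riesz_Re ((0 +i* 1)%C *: h).
rewrite /b /p hdotZl phiZ; case: (dot h y) => u v; case: (phi h) => w t /=.
by rewrite !mul0r !mul1r !sub0r => /oppr_inj -> ->.
Qed.

End Riesz.

End HilbertTheory.

Definition bounded_linear (R : realType) (V : normedModType R[i])
    (T : V -> V) : Prop :=
  linear T /\ exists M : R[i], forall x, `|T x| <= M * `|x|.

Section BoundedOp.
Variables (R : realType) (V : normedModType R[i]).

Record boundedop := BoundedOp {
  bop_fun : V -> V;
  bop_bounded_linear : bounded_linear bop_fun
}.
Coercion bop_fun : boundedop >-> Funclass.

HB.instance Definition _ := gen_eqMixin boundedop.
HB.instance Definition _ := gen_choiceMixin boundedop.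

Implicit Types S T U : boundedop.

Lemma bopP S T : (forall x, S x = T x) -> S = T.
Proof.
case: S T => [f fP] [g gP] /= fg; have fgE : f = g by apply/funext.
by rewrite fgE in fP *; congr BoundedOp; exact: Prop_irrelevance.
Qed.

Lemma bopZD T (l : R[i]) x y : T (l *: x + y) = l *: T x + T y.
Proof. by case: T => f [fl ?]; exact: fl. Qed.

Lemma bop0 T : T 0 = 0.
Proof. by have := bopZD T (-1) 0 0; rewrite scaler0 addr0 scaleN1r addNr. Qed.

Lemma bopD T x y : T (x + y) = T x + T y.
Proof. by have := bopZD T 1 x y; rewrite !scale1r. Qed.

Lemma bopZ T (l : R[i]) x : T (l *: x) = l *: T x.
Proof. by have := bopZD T l x 0; rewrite bop0 !addr0. Qed.

Lemma bop_bound T : exists2 M : R[i], 0 <= M & forall x, `|T x| <= M * `|x|.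
Proof.
have [_ [M TM]] := bop_bounded_linear T; exists `|M| => // x.
rewrite -[`|x|]normr_id -normrM ger0_norm //.
exact: le_trans (TM x).
Qed.

Definition mkbop (f : V -> V) (fl : linear f)
    (fb : exists M : R[i], forall x, `|f x| <= M * `|x|) : boundedop :=
  BoundedOp (conj fl fb).

Lemma bop_add_subproof S T : bounded_linear (fun x => S x + T x).
Proof.
split => [l x y /=|]; first by rewrite !bopZD scalerDr addrACA.
have [M _ SM] := bop_bound S; have [N _ TN] := bop_bound T.
by exists (M + N) => x; rewrite mulrDl (le_trans (ler_normD _ _)) // lerD.
Qed.

Lemma bop_scale_subproof (l : R[i]) T : bounded_linear (fun x => l *: T x).
Proof.
split => [k x y /=|]; first by rewrite bopZD scalerDr !scalerA mulrC.
have [M _ TM] := bop_bound T; exists (`|l| * M) => x.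
by rewrite normrZ -mulrA ler_wpM2l.
Qed.

Lemma bop_opp_subproof T : bounded_linear (fun x => - T x).
Proof.
have [fl fb] := bop_scale_subproof (-1) T.
split => [l x y /=|]; first by rewrite bopZD opprD scalerN.
by have [M TM] := fb; exists M => x; have := TM x; rewrite scaleN1r.
Qed.

Lemma bop_zero_subproof : bounded_linear (fun _ : V => 0 : V).
Proof.
split => [l x y /=|]; first by rewrite scaler0 addr0.
by exists 0 => x; rewrite normr0 mul0r.
Qed.

Let zerob := BoundedOp bop_zero_subproof.
Let addb S T := BoundedOp (bop_add_subproof S T).
Let oppb T := BoundedOp (bop_opp_subproof T).
Let scaleb l T := BoundedOp (bop_scale_subproof l T).

Let addbA : associative addb.
Proof. by move=> S T U; apply: bopP => x; exact: addrA. Qed.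
Let addbC : commutative addb.
Proof. by move=> S T; apply: bopP => x; exact: addrC. Qed.
Let add0b : left_id zerob addb.
Proof. by move=> T; apply: bopP => x; exact: add0r. Qed.
Let addNb : left_inverse zerob oppb addb.
Proof. by move=> T; apply: bopP => x; exact: addNr. Qed.

HB.instance Definition _ :=
  GRing.isZmodule.Build boundedop addbA addbC add0b addNb.

Let scalebA l m T : scaleb l (scaleb m T) = scaleb (l * m) T.
Proof. by apply: bopP => x; exact: scalerA. Qed.
Let scale1b : left_id 1 scaleb.
Proof. by move=> T; apply: bopP => x; exact: scale1r. Qed.
Let scalebDr : right_distributive scaleb +%R.
Proof. by move=> l S T; apply: bopP => x; exact: scalerDr. Qed.
Let scalebDl T : {morph scaleb^~ T : l m / l + m}.
Proof. by move=> l m; apply: bopP => x; exact: scalerDl. Qed.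

HB.instance Definition _ := GRing.Zmodule_isLmodule.Build R[i] boundedop
  scalebA scale1b scalebDr scalebDl.

Lemma bopDE S T x : (S + T) x = S x + T x. Proof. by []. Qed.
Lemma bopNE T x : (- T) x = - T x. Proof. by []. Qed.
Lemma bopZE (l : R[i]) T x : (l *: T) x = l *: T x. Proof. by []. Qed.
Lemma bop0E x : (0 : boundedop) x = 0. Proof. by []. Qed.

Definition opnorm T : R[i] := supnorm [set x : V | `|x| <= 1] T.

Let bop_bounded T : bounded_on [set x : V | `|x| <= 1] T.
Proof.
have [M M0 TM] := bop_bound T; exists M => x /= x1.
by rewrite (le_trans (TM x)) // ler_piMr.
Qed.

Lemma opnorm_ub T x : `|T x| <= opnorm T * `|x|.
Proof.
have [->|x0] := eqVneq x 0; first by rewrite bop0 !normr0 mulr0.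
have nx0 : 0 < `|x| by rewrite normr_gt0.
have := @supnorm_ub _ _ _ _ T (`|x|^-1 *: x) (bop_bounded T).
rewrite /= bopZ !normrZ normfV normr_id mulVf ?gt_eqF // lexx => /(_ isT).
by rewrite mulrC ler_pdivrMr.
Qed.

Lemma opnorm_le T (M : R[i]) : 0 <= M -> (forall x, `|T x| <= M * `|x|) ->
  opnorm T <= M.
Proof.
move=> M0 TM; apply: supnorm_le => // x /= x1.
by rewrite (le_trans (TM x)) // ler_piMr.
Qed.

Lemma opnorm_ge0 T : 0 <= opnorm T. Proof. exact: supnorm_ge0. Qed.

Let opnormD S T : opnorm (S + T) <= opnorm S + opnorm T.
Proof. exact: supnormD. Qed.

Let opnormZ (l : R[i]) T : opnorm (l *: T) = `|l| * opnorm T.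
Proof. exact: supnormZ. Qed.

Let opnorm_eq0 T : opnorm T = 0 -> T = 0.
Proof.
move=> T0; apply: bopP => x; apply/eqP; rewrite -normr_eq0 eq_le normr_ge0.
by rewrite (le_trans (opnorm_ub T x)) // T0 mul0r.
Qed.

HB.instance Definition _ := Lmodule_isNormed.Build R[i] boundedop
  opnormD opnormZ opnorm_eq0.

Lemma bopnormE T : `|T| = opnorm T. Proof. by []. Qed.

Lemma bopnorm_ub T x : `|T x| <= `|T| * `|x|.
Proof. exact: opnorm_ub. Qed.

Lemma bopnorm_le T (M : R[i]) : 0 <= M -> (forall x, `|T x| <= M * `|x|) ->
  `|T| <= M.
Proof. exact: opnorm_le. Qed.

End BoundedOp.

Section BoundedOpComplete.
Variables (R : realType) (V : completeNormedModType R[i]).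
Local Notation BV := (boundedop V).

Lemma bop_cauchy_cvg (F : set_system BV) :
  ProperFilter F -> cauchy F -> cvg F.
Proof.
move=> FF /cauchy_ballP Fc.
have bdist (S T : BV) x e : ball S e T -> `|S x - T x| <= e * `|x|.
  rewrite -ball_normE /= => ST; rewrite -bopNE -bopDE.
  by rewrite (le_trans (bopnorm_ub _ _)) // ler_wpM2r // ltW.
have Fx x : cvg ((fun T : BV => T x) @ F).
  apply/cauchy_cvgP/cauchy_ballP => e e0; rewrite near_map2.
  have d0 : 0 < e / (`|x| + 1) by rewrite divr_gt0 // ltr_wpDl.
  apply: filterS (Fc _ d0) => -[S T] /= ST.
  rewrite -!ball_normE /=; apply: le_lt_trans (bdist _ _ x _ ST) _.
  by rewrite mulrAC ltr_pdivrMr ?ltr_wpDl // ltr_pM2l // ltrDl.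
pose l x := lim ((fun T : BV => T x) @ F).
have Fl e : 0 < e -> \forall T \near F, forall x, `|l x - (T : BV) x| <= e * `|x|.
  move=> e0; have e20 : 0 < e / 2 by rewrite divr_gt0.
  near=> T => x; have [->|x0] := eqVneq x 0.
    rewrite normr0 mulr0 bop0 subr0 /l.
    suff -> : (fun T : BV => T 0) = cst 0 by rewrite lim_cst // normr0.
    by apply/funext => S; rewrite bop0.
  near F => S.
  rewrite -(subrK (S x) (l x)) -addrA (le_trans (ler_normD _ _)) //.
  rewrite [e]splitr mulrDl lerD //.
    rewrite ltW //; near: S; apply: cvgr_dist_lt; first exact: Fx.
    by rewrite mulr_gt0 // normr_gt0.
  rewrite distrC; apply: bdist.
  by near: S; near: T; apply: nearP_dep; exact: Fc.
have ll : linear l.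
  move=> a x y; apply: cvg_lim => //.
  rewrite (_ : (fun T : BV => T (a *: x + y)) = fun T => a *: T x + T y).
    by apply: cvgD; [apply: cvgZr; exact: Fx | exact: Fx].
  by apply/funext => T; rewrite bopZD.
have lb : exists M : R[i], forall x, `|l x| <= M * `|x|.
  near F => T; exists (1 + `|T|) => x.
  rewrite -(subrK (T x) (l x)) (le_trans (ler_normD _ _)) // mulrDl.
  rewrite lerD ?bopnorm_ub //.
  by move: x; near: T; exact: Fl.
apply/cvg_ex; exists (mkbop ll lb : BV); apply/cvgrPdist_le => e e0.
near=> T; suff lT x : `|l x - (T : BV) x| <= e * `|x|.
  by apply: bopnorm_le; [exact: ltW | exact: lT].
by move: x; near: T; apply: Fl.
Unshelve. all: by end_near. Qed.

HB.instance Definition _ := Uniform_isComplete.Build BV bop_cauchy_cvg.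

End BoundedOpComplete.

Section BoundedOpCStar.
Variables (R : realType) (H : hilbertType R).
Local Notation BH := (boundedop H).
Local Notation dot := (@hdot R H).
Implicit Types S T U : BH.

Lemma bop_comp_subproof S T : bounded_linear (S \o T).
Proof.
split => [l x y /=|]; first by rewrite !bopZD.
exists (`|S| * `|T|) => x /=; rewrite (le_trans (bopnorm_ub _ _)) //.
by rewrite -mulrA ler_wpM2l // bopnorm_ub.
Qed.

Definition bop_comp S T : BH := BoundedOp (bop_comp_subproof S T).

Lemma adjoint_exists T k : exists y, forall h, dot (T h) k = dot h y.
Proof.
apply: (@riesz _ _ (fun h => dot (T h) k) (`|T| * `|k|)).
- by move=> x y; rewrite bopD hdotDl.
- by move=> l x; rewrite bopZ hdotZl.
- move=> x; rewrite (le_trans (hdot_CS _ _)) // mulrAC.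
  by rewrite ler_wpM2r // bopnorm_ub.
Qed.

Definition adj_fun T k : H := projT1 (cid (adjoint_exists T k)).

Lemma adj_funE T h k : dot (T h) k = dot h (adj_fun T k).
Proof. exact: (projT2 (cid (adjoint_exists T k))). Qed.

Lemma adj_subproof T : bounded_linear (adj_fun T).
Proof.
split => [l x y|].
  by apply: hdot_inj => h; rewrite -adj_funE !(hdotDr, hdotZr) -!adj_funE.
exists `|T| => x; have [->|y0] := eqVneq (adj_fun T x) 0.
  by rewrite normr0 mulr_ge0.
rewrite -(@ler_pM2r _ `|adj_fun T x|) ?normr_gt0 // -expr2.
rewrite hdot_norm -adj_funE -[leLHS]ger0_norm; last first.
  by rewrite adj_funE dnorm_ge0.
rewrite (le_trans (hdot_CS _ _)) // mulrAC ler_wpM2r //.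
exact: bopnorm_ub.
Qed.

Definition adj T : BH := BoundedOp (adj_subproof T).

Lemma adjE T h k : dot (T h) k = dot h (adj T k).
Proof. exact: adj_funE. Qed.

Lemma adjEr T h k : dot (adj T h) k = dot h (T k).
Proof. by rewrite hdotC -adjE -hdotC. Qed.

Let compA : associative bop_comp.
Proof. by move=> S T U; apply: bopP. Qed.
Let compDl : left_distributive bop_comp +%R.
Proof. by move=> S T U; apply: bopP. Qed.
Let compDr : right_distributive bop_comp +%R.
Proof. by move=> S T U; apply: bopP => x; exact: bopD. Qed.
Let compZl (l : R[i]) S T : bop_comp (l *: S) T = l *: bop_comp S T.
Proof. exact: bopP. Qed.
Let compZr (l : R[i]) S T : bop_comp S (l *: T) = l *: bop_comp S T.
Proof. by apply: bopP => x; exact: bopZ. Qed.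
Let norm_comp S T : `|bop_comp S T| <= `|S| * `|T|.
Proof.
apply: bopnorm_le => [|x]; first by rewrite mulr_ge0.
rewrite (le_trans (bopnorm_ub S (T x))) //.
by rewrite -mulrA ler_wpM2l // bopnorm_ub.
Qed.
Let adjK : involutive adj.
Proof. by move=> T; apply: bopP => x; apply: hdot_inj => h; rewrite -adjE adjEr. Qed.
Let adjD : {morph adj : S T / S + T}.
Proof.
move=> S T; apply: bopP => x; apply: hdot_inj => h.
by rewrite -adjE !bopDE hdotDl hdotDr !adjE.
Qed.
Let adjZ (l : R[i]) T : adj (l *: T) = l^* *: adj T.
Proof.
apply: bopP => x; apply: hdot_inj => h.
by rewrite -adjE !bopZE hdotZl hdotZr conjCK adjE.
Qed.
Let adjM S T : adj (bop_comp S T) = bop_comp (adj T) (adj S).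
Proof.
apply: bopP => x; apply: hdot_inj => h.
by rewrite -adjE /= adjE adjE.
Qed.
Let norm_adj_le T : `|adj T| <= `|T|.
Proof.
apply: bopnorm_le => // x; have [->|y0] := eqVneq (adj T x) 0.
  by rewrite normr0 mulr_ge0.
rewrite -(@ler_pM2r _ `|adj T x|) ?normr_gt0 // -expr2.
rewrite hdot_norm -adjE -[leLHS]ger0_norm; last by rewrite adjE dnorm_ge0.
by rewrite (le_trans (hdot_CS _ _)) // mulrAC ler_wpM2r // bopnorm_ub.
Qed.
Let norm_adj_comp T : `|bop_comp (adj T) T| = `|T| ^+ 2.
Proof.
apply/eqP; rewrite eq_le; apply/andP; split.
  by rewrite (le_trans (norm_comp _ _)) // expr2 ler_wpM2r // norm_adj_le.
rewrite -[leRHS]sqrtCK lerXn2r ?nnegrE ?sqrtC_ge0 //.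
apply: bopnorm_le => [|x]; first by rewrite sqrtC_ge0.
rewrite -(@ler_pXn2r _ 2) ?nnegrE ?mulr_ge0 ?sqrtC_ge0 // exprMn sqrtCK.
rewrite hdot_norm adjE -[leLHS]ger0_norm; last by rewrite -adjE dnorm_ge0.
rewrite (le_trans (hdot_CS _ _)) // mulrC expr2 mulrA ler_wpM2r //.
exact: (bopnorm_ub (bop_comp (adj T) T)).
Qed.

HB.instance Definition _ := @isCStar.Build R BH bop_comp adj
  compA compDl compDr compZl compZr norm_comp
  adjK adjD adjZ adjM norm_adj_comp.

End BoundedOpCStar.

Definition cpositive (R : realType) (A : cstarType R) (a : A) : Prop :=
  exists b : A, a = cmul (star b) b.

(* Boundedness is not imposed: every order automorphism is automatically
   bounded. *)
Definition order_automorphisms (R : realType) (A : cstarType R) : set (A -> A) :=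
  [set phi | [/\ linear phi, bijective phi &
               forall a, cpositive (phi a) <-> cpositive a]].

(* E is meant to be a subset of B(V); this is not assumed, but
   [algebraically_reflexive E] implies it, since [ref_al E] is one. *)
Definition ref_al (R : realType) (V : completeNormedModType R[i])
    (E : set (V -> V)) : set (V -> V) :=
  [set T | bounded_linear T /\ forall x, [set S x | S in E] (T x)].

Definition algebraically_reflexive (R : realType)
    (V : completeNormedModType R[i]) (E : set (V -> V)) : Prop :=
  ref_al E = E.

Definition separable_space (T : topologicalType) : Prop :=
  exists2 D : set T, countable D & dense D.

(* Main.v *)
(** A map [T] agreeing at each point with some order automorphism is injective
    and reflects positivity, so only its surjectivity is at stake, and after
    composing with the inverse of an order automorphism one may assume
    [T 1 = 1].

    An order automorphism [S] of [C(X, B(H))] conjugates the multiplication by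
    [f >= 0] in [C(X)] into a map [D] with [0 <= D F <= l F] for [F >= 0]; such
    a [D] is the multiplication by a scalar function, so [S (f G) = Th f * S G]
    for an order automorphism [Th] of [C(X)]. It follows that [T (f 1)] is
    scalar valued and that [f |-> T (f 1)] agrees at each point with an order
    automorphism of [C(X)]; by hypothesis it is one, hence a composition with a
    homeomorphism [p], and [T F x = E_x (F (p x))] where [E_x] is unital and
    agrees at each operator with an order automorphism of [B(H)].

    Order automorphisms of [B(H)] preserve extremal rays, hence the positive
    rank one operators [rk1 h h = h h^*], so Wigner's argument gives
    [E_x (rk1 h h) = rk1 (V h) (V h)] for a linear or conjugate linear isometry
    [V]. When [H] is separable there is an operator [A0] such that a positive
    functional vanishing at [A0] vanishes at all [rk1 h h]; this property passes
    to [E_x A0] and forces [V] to be onto.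
    Then [<E_x A (V h), V h> = <A h, h>] for all [A], so that [E_x] is bijective
    with an inverse bounded by 2, and [F (p x) = E_x^-1 (G x)] defines a
    continuous preimage [F] of any [G]. *)

Require Import Defs.
From mathcomp Require Import all_boot all_order all_algebra.
From mathcomp Require Import lra ring.
From mathcomp Require Import all_classical all_reals all_analysis.

Set Implicit Arguments.
Unset Strict Implicit.
Unset Printing Implicit Defensive.

Import Order.TTheory GRing.Theory Num.Theory.
Import numFieldNormedType.Exports.
From mathcomp Require Import complex.

Local Open Scope classical_set_scope.
Local Open Scope ring_scope.

(** * Maps satisfying the predicate [linear] *)

Section LinearProp.
Variables (K : pzRingType) (U V : lmodType K) (f : U -> V).
Hypothesis lf : linear f.

Lemma linear0_of : f 0 = 0.
Proof. by have := lf (-1) 0 0; rewrite scaler0 addr0 scaleN1r addNr. Qed.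

Lemma linearD_of x y : f (x + y) = f x + f y.
Proof. by have := lf 1 x y; rewrite !scale1r. Qed.

Lemma linearZ_of l x : f (l *: x) = l *: f x.
Proof. by have := lf l x 0; rewrite linear0_of !addr0. Qed.

Lemma linearN_of x : f (- x) = - f x.
Proof. by rewrite -scaleN1r linearZ_of scaleN1r. Qed.

Lemma linearB_of x y : f (x - y) = f x - f y.
Proof. by rewrite linearD_of linearN_of. Qed.

End LinearProp.

(** * Convergence of sequences with dominated increments *)

Section DominatedSequence.
Variables (R : realType) (V : completeNormedModType R[i]).
Variables (u : nat -> V) (s : nat -> R).
Hypothesis us : forall n, `|u n.+1 - u n| <= (s n.+1 - s n)%:C%C.
Hypothesis s1 : forall n, s n <= 1.

Lemma dominated_dist n k : `|u (n + k)%N - u n| <= (s (n + k)%N - s n)%:C%C.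
Proof.
elim: k => [|k IH]; first by rewrite addn0 !subrr normr0.
rewrite addnS -(subrK (u (n + k)%N) (u _.+1)) -addrA.
rewrite (le_trans (ler_normD _ _)) // (le_trans (lerD (us _) IH)) //.
by rewrite -rmorphD /= addrA subrK.
Qed.

(** By [us] the sequence [s] is nondecreasing; being bounded by 1 it converges, and its tails bound
    those of [u]. *)
Lemma dominated_cvg : exists l : V, forall e : R[i], 0 < e ->
  exists N, forall n, (N <= n)%N -> `|l - u n| <= e.
Proof.
have s_nd : nondecreasing_seq s.
  apply/nondecreasing_seqP => n; rewrite -subr_ge0 -lecR.
  exact: le_trans (us n).
have s_cvg : cvgn s.
  by apply: nondecreasing_is_cvgn => //; exists 1 => _ [n _ <-].
have s_cauchy (e : R[i]) : 0 < e -> exists N, forall n, (N <= n)%N ->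
    (lim (s @ \oo) - s n)%:C%C <= e.
  move=> e0; have eE : (Re e)%:C%C = e by rewrite RRe_real // gtr0_real.
  have Re0 : 0 < Re e by rewrite -ltcR eE.
  have /cvgrPdist_le/(_ _ Re0)[N _ NP] := s_cvg.
  exists N => n Nn; rewrite -eE lecR.
  exact: le_trans (ler_norm _) (NP n Nn).
have s_lim n : s n <= lim (s @ \oo) by exact: nondecreasing_cvgn_le.
have uu n k : `|u (n + k)%N - u n| <= (lim (s @ \oo) - s n)%:C%C.
  by apply: le_trans (dominated_dist n k) _; rewrite lecR lerD2r.
have : cvg (u @ \oo).
  apply/cauchy_cvgP/cauchy_exP => e e0.
  have e20 : 0 < e / 2 by rewrite divr_gt0.
  have [N NP] := s_cauchy _ e20.
  exists (u N); exists N => //= n Nn.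
  rewrite -ball_normE /= distrC -(subnKC Nn) (le_lt_trans (uu _ _)) //.
  by rewrite (le_lt_trans (NP N _)) // ltr_pdivrMr // mulr_natr mulr2n ltrDl.
move=> /cvg_ex[l ul]; exists l => e e0.
by have /cvgrPdist_le/(_ _ e0)[N _ NP] := ul; exists N => n Nn; exact: NP.
Qed.

End DominatedSequence.

(** * Positive elements and positive functionals in the presence of a unit *)

Section Unital.
Variables (R : realType) (A : cstarType R).
Implicit Types a b e : A.

(** [cstarType] carries no unit, so being one is a predicate. The norm is only bounded by 1 because
    the unit of the zero algebra has norm 0. *)
Definition cunital e := [/\ forall a, cmul e a = a, forall a, cmul a e = a,
  star e = e & `|e| <= 1].

(* The limit [y] satisfies [y = (c + y ^ 2) / 2], that is, [(e - y) ^ 2 = e - c].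
   [sqrt_bound] is the same iteration in [R] with [c = 1]; it dominates the
   increments of [sqrt_iter], whence convergence even when [`|c| = 1]. *)
Fixpoint sqrt_iter (c : A) n :=
  if n is n'.+1 then
    2^-1 *: (c + cmul (sqrt_iter c n') (sqrt_iter c n'))
  else 0.

Fixpoint sqrt_bound n : R :=
  if n is n'.+1 then (1 + sqrt_bound n' ^+ 2) / 2 else 0.

Lemma sqrt_bound_itv n : 0 <= sqrt_bound n <= 1.
Proof. by elim: n => [|n /andP[? ?]] /=; [lra | apply/andP; split; nra]. Qed.

Lemma norm_half (a : A) : `|2^-1 *: a| = 2^-1 * `|a|.
Proof. by rewrite normrZ ger0_norm // invr_ge0. Qed.

Lemma sqrt_iter_le c n : `|c| <= 1 -> `|sqrt_iter c n| <= (sqrt_bound n)%:C%C.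
Proof.
move=> c1; elim: n => [|n IH] /=; first by rewrite normr0.
rewrite norm_half rmorphM rmorphD rmorphXn rmorph1 fmorphV rmorph_nat /= mulrC.
rewrite ler_wpM2r ?invr_ge0 // (le_trans (ler_normD _ _)) // lerD //.
by rewrite (le_trans (normr_cmul _ _)) // -expr2 lerXn2r ?nnegrE // ler0c;
   case/andP: (sqrt_bound_itv n).
Qed.

Lemma cmul_sqB a b : cmul a a - cmul b b = cmul a (a - b) + cmul (a - b) b.
Proof. by rewrite cmulBl cmulBr addrA subrK. Qed.

Lemma sqrt_step_norm (c y z : A) :
  `|2^-1 *: (c + cmul z z) - 2^-1 *: (c + cmul y y)| <=
  2^-1 * ((`|z| + `|y|) * `|z - y|).
Proof.
rewrite -scalerBr norm_half opprD addrACA subrr add0r cmul_sqB ler_pM2l //.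
rewrite (le_trans (ler_normD _ _)) // mulrDl lerD ?normr_cmul //.
by rewrite [leRHS]mulrC normr_cmul.
Qed.

(** The increment of the real iteration is [(t + r) * (t - r) / 2], which dominates the bound of
    [sqrt_step_norm]. *)
Lemma sqrt_step_dist (c y z : A) (r t : R) : `|y| <= r%:C%C -> `|z| <= t%:C%C ->
  `|z - y| <= (t - r)%:C%C ->
  `|2^-1 *: (c + cmul z z) - 2^-1 *: (c + cmul y y)| <=
  ((1 + t ^+ 2) / 2 - (1 + r ^+ 2) / 2)%:C%C.
Proof.
move=> yr zt zy; apply: le_trans (sqrt_step_norm c y z) _.
rewrite ler_pdivrMl //.
apply: (@le_trans _ _ (((t + r) * (t - r))%:C%C)); last first.
  by rewrite -[2]/(2%:R) -(rmorph_nat (real_complex R)) -rmorphM lecR /=; lra.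
by rewrite rmorphM rmorphD; apply: ler_pM; rewrite ?addr_ge0 // lerD.
Qed.

Lemma sqrt_iter_dist (c : A) n : `|c| <= 1 ->
  `|sqrt_iter c n.+1 - sqrt_iter c n| <= (sqrt_bound n.+1 - sqrt_bound n)%:C%C.
Proof.
move=> c1; elim: n => [|n IH].
  by have := sqrt_iter_le 1 c1; rewrite !subr0.
exact: (sqrt_step_dist c (sqrt_iter_le n c1) (sqrt_iter_le n.+1 c1) IH).
Qed.

Lemma star_sqrt_iter c n : star c = c -> star (sqrt_iter c n) = sqrt_iter c n.
Proof.
move=> cc; elim: n => [|n IH] /=; first by rewrite -(scale0r 0) starZ rmorph0 !scale0r.
by rewrite starZ starD starM cc IH fmorphV rmorph_nat.
Qed.

Lemma norm_le_eps (V : normedModType R[i]) (v : V) (k : nat) :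
  (forall e : R[i], 0 < e -> `|v| <= e *+ k) -> v = 0.
Proof.
move=> ve; apply/eqP; rewrite -normr_le0; apply/ler_addgt0Pl => d d0.
rewrite addr0; have k0 : 0 < k.+1%:R :> R[i] by rewrite ltr0n.
apply: le_trans (ve (d / k.+1%:R) (divr_gt0 d0 k0)) _.
rewrite -[_ *+ k]mulr_natr -mulrA ler_piMr ?(ltW d0) //.
by rewrite mulrC ler_pdivrMr // mul1r ler_nat.
Qed.

(** With [c = e - a], the limit [l] of [sqrt_iter c] is self-adjoint and [e - l] is a square root of
    [a]. *)
Lemma cpositive_near_unit e a : cunital e -> star a = a -> `|e - a| <= 1 ->
  cpositive a.
Proof.
move=> [el er se _] sa ea1; pose c := e - a.
have sc : star c = c by rewrite /c starB se sa.
pose y := sqrt_iter c.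
have [|l lP] := @dominated_cvg R A y _ (fun n => sqrt_iter_dist n ea1).
  by move=> n; case/andP: (sqrt_bound_itv n).
have y1 n : `|y n| <= 1.
  apply: le_trans (sqrt_iter_le n ea1) _; rewrite -[1]/(1%:C%C) lecR.
  by case/andP: (sqrt_bound_itv n).
have l1 : `|l| <= 2.
  have [N /(_ N (leqnn N)) lN] := lP 1 ltr01.
  rewrite -(subrK (y N) l) (le_trans (ler_normD _ _)) //.
  by rewrite [2]mulr2n lerD.
have sl : star l = l.
  apply/subr0_eq/(norm_le_eps (k := 2)) => d d0; have [N /(_ N (leqnn N)) lN] := lP d d0.
  rewrite -(subrK (y N) (star l)) -addrA (le_trans (ler_normD _ _)) // mulr2n lerD //.
    suff -> : star l - y N = star (l - y N) by rewrite norm_star.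
    by rewrite starB /y star_sqrt_iter.
  by rewrite distrC.
(* Four errors [d]: one for [l - y N.+1], and at most three for the step map, whose Lipschitz factor
   is [(1 + 2) / 2]. *)
have lE : l = 2^-1 *: (c + cmul l l).
  apply/subr0_eq/(norm_le_eps (k := 4)) => d d0; have [N NP] := lP d d0.
  apply: le_trans (ler_distD (y N.+1) _ _) _; rewrite mulrS lerD ?NP //.
  apply: le_trans (sqrt_step_norm c l (y N)) _.
  rewrite ler_pdivrMl // (_ : 2 * _ = 6 * d); last by ring.
  apply: ler_pM; rewrite ?addr_ge0 // ?[`|y N - _|]distrC ?NP //.
  by apply: le_trans (lerD (y1 N) l1) _; rewrite -[1]/(1%:R) -natrD ler_nat.
have ll : l + l = c + cmul l l.
  have h2 : 2^-1 + 2^-1 = 1 :> R[i] by field.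
  by rewrite {1 2}lE -scalerDl h2 scale1r.
exists (e - l); rewrite starB se sl cmulBl !cmulBr !el er.
have -> : cmul l l = l + l - c by rewrite ll addrC addKr.
rewrite /c !opprB !addrA subrK (addrC e l) (addrAC (l + e)) addrK.
by rewrite (addrC l a) addrK.
Qed.

Lemma starN a : star (- a) = - star a.
Proof. by rewrite -scaleN1r starZ rmorphN rmorph1 scaleN1r. Qed.

Lemma cpositiveZ (r : R[i]) a : 0 <= r -> cpositive a -> cpositive (r *: a).
Proof.
move=> r0 [b ->]; exists (sqrtC r *: b).
have sr : (sqrtC r)^* = sqrtC r by apply/CrealP; rewrite ger0_real ?sqrtC_ge0.
by rewrite starZ cmulZl cmulZr scalerA sr -expr2 sqrtCK.
Qed.

Lemma cpositive0 : cpositive (0 : A).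
Proof. by exists 0; rewrite -{3}(scale0r 0) cmulZr scale0r. Qed.

Lemma cpositive_unit e : cunital e -> cpositive e.
Proof. by move=> eP; have [el _ se _] := eP; exists e; rewrite se el. Qed.

Lemma cpositive_shift e a (m : R[i]) : cunital e -> star a = a -> `|a| <= m ->
  cpositive (m *: e + a).
Proof.
move=> eP sa am; have m0 : 0 <= m by apply: le_trans am.
have mR : (m^-1)^* = m^-1 by apply/CrealP; rewrite ger0_real ?invr_ge0.
have [m00|mN0] := eqVneq m 0.
  have -> : a = 0 by apply/normr0_eq0/le_anti; rewrite normr_ge0 -m00 am.
  by rewrite m00 scale0r addr0; exact: cpositive0.
have -> : m *: e + a = m *: (e + m^-1 *: a).
  by rewrite scalerDr scalerA mulfV // scale1r.
apply: cpositiveZ => //; have [_ _ se _] := eP.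
apply: (cpositive_near_unit eP).
  by rewrite starD starZ sa se mR.
rewrite opprD addrA subrr add0r normrN normrZ normfV (ger0_norm m0).
by rewrite mulrC ler_pdivrMr ?mul1r // lt_neqAle eq_sym mN0.
Qed.

(** Dividing by the norm of [a] reduces to [cpositive_near_unit]. The norm hypothesis can be checked
    directly in [B(H)], [C(X)] and [C(X, B(H))], which identifies their positive elements. *)
Lemma cpositive_scaled e a : cunital e -> star a = a ->
  `| `|a| *: e - a| <= `|a| -> cpositive a.
Proof.
move=> eP sa ea; have [->|a0] := eqVneq a 0; first exact: cpositive0.
have n0 : 0 < `|a| by rewrite normr_gt0.
have cR : (`|a|^-1)^* = `|a|^-1 by apply/CrealP; rewrite ger0_real ?invr_ge0.
have -> : a = `|a| *: (`|a|^-1 *: a) by rewrite scalerA divff ?scale1r ?gt_eqF.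
apply: cpositiveZ => //; apply: (cpositive_near_unit eP); first by rewrite starZ sa cR.
have -> : e - `|a|^-1 *: a = `|a|^-1 *: (`|a| *: e - a).
  by rewrite scalerBr scalerA mulVf ?scale1r ?gt_eqF.
by rewrite normrZ normfV normr_id ler_pdivrMl ?mulr1.
Qed.

(** [u] and [w] are the real part [(a + star a) / 2] and the imaginary part
    ['i * (star a - a) / 2]. *)
Lemma star_decomposition a : exists u w,
  [/\ a = u + 'i *: w, star u = u, star w = w, `|u| <= `|a| & `|w| <= `|a|].
Proof.
have h2 : 2^-1 + 2^-1 = 1 :> R[i] by field.
have c2 : (2^-1 : R[i])^* = 2^-1 by apply/CrealP; rewrite ger0_real ?invr_ge0.
have na (b : A) : `|b| <= `|a| + `|star a| -> `|2^-1 *: b| <= `|a|.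
  move=> ba; rewrite norm_half ler_pdivrMl //; apply: le_trans ba _.
  by rewrite norm_star [leRHS]mulrDl mul1r.
exists (2^-1 *: (a + star a)), (2^-1 *: ('i *: (star a - a))); split.
- rewrite !scalerA [X in _ + X *: _](_ : _ = - 2^-1); last first.
    by rewrite mulrAC -expr2 sqrCi mulN1r.
  by rewrite scaleNr -scalerN opprB -scalerDr addrCA addrK scalerDr -scalerDl h2 scale1r.
- by rewrite starZ starD starK c2 addrC.
- by rewrite starZ starZ starB starK c2 conjCi scaleNr -scalerN opprB.
- by apply: na; exact: ler_normD.
- by apply: na; rewrite normrZ normCi mul1r [leRHS]addrC ler_normB.
Qed.

(** Positive elements span: a self-adjoint [b] is the difference of [|b| e + b] and [|b| e]. *)
Lemma linear_cpositive_ext (V : lmodType R[i]) (e : A) (f g : A -> V) :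
  cunital e -> linear f -> linear g ->
  (forall a, cpositive a -> f a = g a) -> forall a, f a = g a.
Proof.
move=> eP lf lg fg a; have [u [w [-> su sw _ _]]] := star_decomposition a.
have sa b : star b = b -> f b = g b.
  move=> sb; have := fg _ (cpositive_shift eP sb (lexx _)).
  rewrite (linearD_of lf) (linearZ_of lf) (linearD_of lg) (linearZ_of lg).
  rewrite (fg _ (cpositive_unit eP)).
  exact: addrI.
by rewrite (linearD_of lf) (linearZ_of lf) (linearD_of lg) (linearZ_of lg) !sa.
Qed.

Lemma linear_cpositive_surj (V : lmodType R[i]) (e : A) (f : V -> A) :
  cunital e -> linear f -> (forall a, cpositive a -> exists v, f v = a) ->
  forall a, exists v, f v = a.
Proof.
move=> eP lf fs a; have [u [w [-> su sw _ _]]] := star_decomposition a.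
have sa b : star b = b -> exists v, f v = b.
  move=> sb; have [v vE] := fs _ (cpositive_shift eP sb (lexx _)).
  have [v' v'E] := fs _ (cpositive_unit eP).
  by exists (v - `|b| *: v'); rewrite (linearB_of lf) (linearZ_of lf) vE v'E addrC addKr.
have [x <-] := sa _ su; have [y <-] := sa _ sw.
by exists (x + 'i *: y); rewrite (linearD_of lf) (linearZ_of lf).
Qed.

(** For self-adjoint [b] both [|b| e + b] and [|b| e - b] are positive, so [|w b| <= |b| w e]; the
    factor 2 comes from adding real and imaginary parts. *)
Lemma positive_functional_bound (e : A) (w : A -> R[i]) : cunital e -> linear w ->
  (forall a, cpositive a -> 0 <= w a) -> forall a, `|w a| <= 2 * `|a| * w e.
Proof.
move=> eP lw w0 a; have [u [v [aE su sv ua va]]] := star_decomposition a.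
have bnd b : star b = b -> `|w b| <= `|b| * w e.
  move=> sb.
  have p1 := w0 _ (cpositive_shift eP sb (lexx _)).
  have sNb : star (- b) = - b by rewrite starN sb.
  have p2 := w0 _ (cpositive_shift eP sNb (lexx _)).
  rewrite (linearD_of lw) (linearZ_of lw) in p1.
  rewrite normrN (linearD_of lw) (linearZ_of lw) (linearN_of lw) in p2.
  have wbR : w b \is Num.real.
    have -> : w b = (`|b| *: w e + w b) - `|b| *: w e by rewrite addrC addKr.
    rewrite rpredB ?ger0_real // mulr_ge0 // w0 //; exact: cpositive_unit.
  rewrite real_ler_norml //; apply/andP; split; last by rewrite -subr_ge0.
  by rewrite -subr_ge0 opprK addrC.
rewrite {1}aE (linearD_of lw) (linearZ_of lw) (le_trans (ler_normD _ _)) //.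
have -> : 'i *: w v = 'i * w v by [].
rewrite normrM normCi mul1r (_ : 2 = 1 + 1) // !mulrDl mul1r.
have we0 : 0 <= w e by apply/w0/cpositive_unit.
by apply: lerD; [apply: le_trans (bnd _ su) _ | apply: le_trans (bnd _ sv) _];
   rewrite ler_wpM2r.
Qed.

End Unital.

(** * The group of order automorphisms *)

Section OrderAutomorphisms.
Variables (R : realType) (A : cstarType R).
Implicit Types S T : A -> A.

Lemma order_automorphisms_inv S T : order_automorphisms S ->
  cancel S T -> cancel T S -> order_automorphisms T.
Proof.
move=> [lS _ pS] ST TS; split; last by move=> a; rewrite -pS TS.
  by move=> l a b; apply: (can_inj ST); rewrite lS !TS.
by exists S.
Qed.

Lemma order_automorphisms_comp S T : order_automorphisms S ->
  order_automorphisms T -> order_automorphisms (S \o T).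
Proof.
move=> [lS bS pS] [lT bT pT]; split; first by move=> l a b /=; rewrite lT lS.
  exact: bij_comp.
by move=> a /=; rewrite pS pT.
Qed.

End OrderAutomorphisms.

(** * Quadratic forms and positive operators on a Hilbert space *)

Section Forms.
Variables (R : realType) (H : hilbertType R).
Local Notation dot := (@hdot R H).
Local Notation BH := (boundedop H).
Implicit Types (A B : BH) (x y h k v : H) (l m : R[i]).

Definition pos_op A := forall h, 0 <= dot (A h) h.

Lemma idb_subproof : bounded_linear (fun x : H => x).
Proof. by split=> //; exists 1 => x; rewrite mul1r. Qed.

Definition idb : BH := BoundedOp idb_subproof.

Lemma cunit_idb : cunital idb.
Proof.
split; [by move=> A; apply: bopP | by move=> A; apply: bopP | |].
  by apply: bopP => x; apply: hdot_inj => h; rewrite -[star idb]/(adj idb) -adjE.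
by apply: bopnorm_le => // x; rewrite mul1r.
Qed.

Lemma rk1_subproof h k : bounded_linear (fun v => dot v k *: h).
Proof.
split=> [l x y|]; first by rewrite hdotDl hdotZl scalerDl scalerA.
exists (`|k| * `|h|) => x; rewrite normrZ mulrAC ler_wpM2r //.
by rewrite mulrC; exact: hdot_CS.
Qed.

Definition rk1 h k : BH := BoundedOp (rk1_subproof h k).

Lemma rk1E h k v : rk1 h k v = dot v k *: h. Proof. by []. Qed.

Lemma rk1Dl x y k : rk1 (x + y) k = rk1 x k + rk1 y k.
Proof. by apply: bopP => v; rewrite bopDE !rk1E scalerDr. Qed.

Lemma rk1Dr x y k : rk1 k (x + y) = rk1 k x + rk1 k y.
Proof. by apply: bopP => v; rewrite bopDE !rk1E hdotDr scalerDl. Qed.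

Lemma rk1Zl l x k : rk1 (l *: x) k = l *: rk1 x k.
Proof. by apply: bopP => v; rewrite bopZE !rk1E !scalerA mulrC. Qed.

Lemma rk1Zr l x k : rk1 k (l *: x) = l^* *: rk1 k x.
Proof. by apply: bopP => v; rewrite bopZE !rk1E hdotZr scalerA. Qed.

Lemma rk1_form h v : dot (rk1 h h v) v = `|dot v h| ^+ 2.
Proof. by rewrite rk1E hdotZl [dot h v]hdotC normCK. Qed.

Lemma pos_rk1 h : pos_op (rk1 h h).
Proof. by move=> v; rewrite rk1_form exprn_ge0. Qed.

Lemma dot_ge0 x : 0 <= dot x x. Proof. by rewrite -hdot_norm exprn_ge0. Qed.

Lemma dot_eq0 x : (dot x x == 0) = (x == 0).
Proof. by rewrite -hdot_norm expf_eq0 normr_eq0. Qed.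

Lemma dot0l x : dot 0 x = 0.
Proof. by rewrite -(scale0r 0) hdotZl mul0r. Qed.

Lemma dot0r x : dot x 0 = 0.
Proof. by rewrite hdotC dot0l rmorph0. Qed.

Lemma form_linear h : linear (fun A => dot (A h) h : R[i]).
Proof. by move=> l A B; rewrite bopDE bopZE hdotDl hdotZl. Qed.

Lemma bopN A x : A (- x) = - A x.
Proof. by rewrite -scaleN1r bopZ scaleN1r. Qed.

Lemma polarization A x y :
  4 * dot (A x) y = dot (A (x + y)) (x + y) - dot (A (x - y)) (x - y)
  + 'i * (dot (A (x + 'i *: y)) (x + 'i *: y)
  - dot (A (x - 'i *: y)) (x - 'i *: y)).
Proof.
rewrite !(bopD, bopN, hdotDl, hdotDr, hdotNl, hdotNr, bopZ, hdotZl, hdotZr) conjCi.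
have ii : 'i * 'i = -1 :> R[i] by rewrite -expr2 sqrCi.
ring: ii.
Qed.

Lemma form_eq0 A : (forall h, dot (A h) h = 0) -> A = 0.
Proof.
move=> A0; apply: bopP => x; apply/eqP; rewrite -dot_eq0.
have /eqP := polarization A x (A x); rewrite !A0 !subrr mulr0 addr0.
by rewrite mulf_eq0 pnatr_eq0.
Qed.

Lemma form_inj A B : (forall h, dot (A h) h = dot (B h) h) -> A = B.
Proof.
move=> AB; apply/subr0_eq/form_eq0 => h.
by rewrite bopDE bopNE hdotDl hdotNl AB subrr.
Qed.

(** Polarization and the parallelogram law give [|<A x, y>| <= m (|x|^2 + |y|^2)]; then [y] is taken
    to be [A x] rescaled to the length of [x]. *)
Lemma numeric_radius A m : 0 <= m -> (forall h, `|dot (A h) h| <= m * dot h h) ->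
  `|A| <= 2 * m.
Proof.
move=> m0 Am.
have bnd x y : `|dot (A x) y| <= m * (dot x x + dot y y).
  rewrite -(@ler_pM2l _ 4) // -[X in X * `|_|](@ger0_norm _ 4) // -normrM polarization.
  apply: le_trans (ler_normD _ _) _; rewrite normrM normCi mul1r.
  apply: le_trans (lerD (ler_normB _ _) (ler_normB _ _)) _.
  apply: le_trans (lerD (lerD (Am _) (Am _)) (lerD (Am _) (Am _))) _.
  rewrite -!mulrDr mulrCA ler_wpM2l //.
  rewrite !(hdotDl, hdotDr, hdotNl, hdotNr, hdotZl, hdotZr) conjCi.
  have ii : 'i * 'i = -1 :> R[i] by rewrite -expr2 sqrCi.
  by rewrite le_eqVlt; apply/orP; left; apply/eqP; ring: ii.
apply: bopnorm_le => [|x]; first by rewrite mulr_ge0.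
have [->|Ax0] := eqVneq (A x) 0; first by rewrite normr0 !mulr_ge0.
have [x0|x0] := eqVneq x 0; first by rewrite x0 bop0 eqxx in Ax0.
have nA0 : 0 < `|A x| by rewrite normr_gt0.
have nx0 : 0 < `|x| by rewrite normr_gt0.
pose t := `|x| / `|A x|; have t0 : 0 <= t by rewrite divr_ge0.
have tA : t * `|A x| = `|x| by rewrite divfK ?gt_eqF.
have tR : t^* = t by apply/CrealP; rewrite ger0_real.
have := bnd x (t *: A x); rewrite -[dot (_ *: _) _]hdot_norm normrZ (ger0_norm t0).
rewrite tA hdotZr tR -!hdot_norm expr2 mulrA tA normrM !normr_id.
rewrite (_ : m * _ = `|x| * (2 * m * `|x|)); last by ring.
by rewrite ler_pM2l.
Qed.

Lemma pos_sym A x y : pos_op A -> dot (A x) y = dot x (A y).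
Proof.
move=> pA; rewrite adjE; congr (dot x _); congr (bop_fun _ y).
apply: form_inj => h; rewrite adjEr [LHS]hdotC.
by apply/CrealP; rewrite ger0_real.
Qed.

Lemma pos_star A : pos_op A -> star A = A.
Proof. by move=> pA; apply: bopP => x; apply: hdot_inj => h; rewrite -adjE pos_sym. Qed.

(** Cauchy-Schwarz for the semi-inner product [<A x, y>], from its positivity at [a v - b h]. *)
Lemma pos_CS A h v : pos_op A -> 0 < dot (A h) h ->
  `|dot v (A h)| ^+ 2 <= dot (A h) h * dot (A v) v.
Proof.
move=> pA a0; set a := dot (A h) h in a0 *; set b := dot v (A h).
have aR : a^* = a by apply/CrealP; rewrite gtr0_real.
have := pA (a *: v - b *: h).
rewrite !(bopD, hdotDl, hdotDr, bopZ, hdotZl, hdotZr) -!scaleNr.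
rewrite !(bopZ, hdotZl, hdotZr) rmorphN /= aR -/a.
rewrite [dot (A h) v]hdotC [dot (A v) h]pos_sym // -/b.
rewrite [X in 0 <= X](_ : _ = a * (a * dot (A v) v - b * b^*)); last first.
  by ring.
by rewrite pmulr_rge0 // subr_ge0 -normCK.
Qed.

Lemma pos_ker A h : pos_op A -> dot (A h) h = 0 -> A h = 0.
Proof.
move=> pA Ah0; apply/eqP; apply: contraT => Ah.
set b := dot (A h) (A h).
have b0 : 0 < b by rewrite lt_neqAle dot_ge0 eq_sym dot_eq0 Ah.
set c := dot (A (A h)) (A h); have c0 : 0 <= c by exact: pA.
(* The form of [A] at [A h - t h] is [c - 2 t b], which this [t] turns into [- (c + 2)]. *)
pose t := (c + 1) / b.
have tR : t^* = t by apply/CrealP; rewrite ger0_real // divr_ge0 ?addr_ge0 // ltW.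
have := pA (A h - t *: h).
rewrite -scaleNr !(bopD, hdotDl, hdotDr, bopZ, hdotZl, hdotZr) rmorphN /= tR.
rewrite Ah0 [dot (A (A h)) h]pos_sym // -/b -/c.
rewrite [X in 0 <= X](_ : _ = - (c + 2)); last by rewrite /t; field; rewrite gt_eqF.
by rewrite oppr_ge0 lt_geF // ltr_wpDl.
Qed.

(* The form of the difference vanishes at [h]: this is what replaces normality
   for the positive maps below. *)
Lemma pos_sub_rk1 A h : pos_op A -> 0 < dot (A h) h ->
  pos_op (A - (dot (A h) h)^-1 *: rk1 (A h) (A h)).
Proof.
move=> pA a0 v; rewrite bopDE bopNE bopZE hdotDl hdotNl hdotZl rk1_form.
by rewrite subr_ge0 ler_pdivrMl // pos_CS.
Qed.

Lemma posD A B : pos_op A -> pos_op B -> pos_op (A + B).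
Proof. by move=> pA pB h; rewrite bopDE hdotDl addr_ge0. Qed.

Lemma posZ l A : 0 <= l -> pos_op A -> pos_op (l *: A).
Proof. by move=> l0 pA h; rewrite bopZE hdotZl; exact: mulr_ge0. Qed.

Lemma pos_bound A h : pos_op A -> dot (A h) h <= `|A| * dot h h.
Proof.
move=> pA; rewrite -[leLHS]ger0_norm //; apply: le_trans (hdot_CS _ _) _.
by rewrite -hdot_norm expr2 mulrA ler_wpM2r // bopnorm_ub.
Qed.

(** [pos_CS] at [v = A h] bounds [|A h|^4] by [m |h|^2] times [m |A h|^2]. *)
Lemma pos_norm A m : 0 <= m -> pos_op A -> (forall h, dot (A h) h <= m * dot h h) ->
  `|A| <= m.
Proof.
move=> m0 pA Am; apply: bopnorm_le => // h.
have [Ah0|/eqP Ah0] := pselect (A h = 0); first by rewrite Ah0 normr0 mulr_ge0.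
have a0 : 0 < dot (A h) h.
  rewrite lt_neqAle pA eq_sym andbT; apply: contraNN Ah0 => /eqP.
  by move=> /(pos_ker pA)/eqP.
have := pos_CS (A h) pA a0.
rewrite -!hdot_norm normrX normr_id => CS.
have n0 : 0 < `|A h| ^+ 2 by rewrite exprn_gt0 // normr_gt0.
have : `|A h| ^+ 2 * `|A h| ^+ 2 <= (m * `|h|) ^+ 2 * `|A h| ^+ 2.
  rewrite -expr2; apply: le_trans CS _.
  apply: le_trans (ler_pM (ltW a0) (pA _) (Am _) (Am _)) _.
  by rewrite -!hdot_norm le_eqVlt; apply/orP; left; apply/eqP; ring.
by rewrite ler_pM2r // ler_pXn2r ?nnegrE ?mulr_ge0.
Qed.

Lemma pos_norm_compl A m : pos_op A -> `|A| <= m -> `|m *: idb - A| <= m.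
Proof.
move=> pA Am; have m0 : 0 <= m by apply: le_trans Am.
apply: pos_norm => // h; rewrite bopDE bopNE bopZE hdotDl hdotNl hdotZl.
  by rewrite subr_ge0 (le_trans (pos_bound _ pA)) // ler_wpM2r // dot_ge0.
by rewrite lerBlDr lerDl.
Qed.

Lemma pos_op_cpositive A : pos_op A <-> cpositive A.
Proof.
split=> [pA|[B ->] h]; last by rewrite -[X in _ <= X]/(dot (adj B (B h)) h) adjEr dot_ge0.
by apply: (cpositive_scaled cunit_idb (pos_star pA)); exact: pos_norm_compl.
Qed.

(** The multiples of [rk1 h h] form an extremal ray: [B] vanishes on the orthogonal of [h], since
    its form does, and symmetry of [B] determines the rest. *)
Lemma below_rk1 B h m : pos_op B -> pos_op (m *: rk1 h h - B) ->
  B = (dot (B h) h / dot h h ^+ 2) *: rk1 h h.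
Proof.
have [->|h0] := eqVneq h 0.
  move=> pB pm; apply: form_inj => v.
  have := pm v; rewrite bopDE bopNE bopZE hdotDl hdotNl hdotZl !rk1_form.
  rewrite !dot0r normr0 expr0n mulr0 sub0r oppr_ge0 bopZE hdotZl rk1_form dot0r.
  by rewrite normr0 expr0n mulr0 => v0; apply/le_anti; rewrite v0 pB.
move=> pB pm.
have hh0 : dot h h != 0 by rewrite dot_eq0.
have Bperp v : dot v h = 0 -> B v = 0.
  move=> vh; apply: pos_ker => //; apply/le_anti; rewrite pB andbT.
  have := pm v; rewrite bopDE bopNE bopZE hdotDl hdotNl hdotZl rk1_form vh.
  by rewrite normr0 expr0n mulr0 sub0r oppr_ge0.
have BhE v : B v = (dot v h / dot h h) *: B h.
  have := Bperp (v - (dot v h / dot h h) *: h).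
  rewrite hdotDl hdotNl hdotZl divfK // subrr bopD -scaleNr bopZ scaleNr.
  by move=> /(_ erefl)/subr0_eq.
have hhR : (dot h h)^* = dot h h by apply/CrealP; rewrite ger0_real ?dot_ge0.
apply: form_inj => v; rewrite bopZE hdotZl rk1_form BhE hdotZl (pos_sym h v pB).
rewrite [B v]BhE hdotZr -(pos_sym h h pB) rmorphM fmorphV /= hhR normCK.
by field.
Qed.

End Forms.

(** * Order automorphisms of [B(H)] and rank one operators *)

Section OperatorOrder.
Variables (R : realType) (H : hilbertType R).
Local Notation dot := (@hdot R H).
Local Notation BH := (boundedop H).
Local Notation idb := (idb H).
Implicit Types (A B : BH) (x y h k v : H) (l m : R[i]).

Lemma rk1_normr_eq h k : rk1 h h = rk1 k k -> dot h h = dot k k.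
Proof.
suff le x y : rk1 x x = rk1 y y -> dot x x <= dot y y.
  by move=> E; apply/le_anti; rewrite !le.
move=> E; have [->|x0] := eqVneq x 0; first by rewrite dot0l dot_ge0.
have xx0 : 0 < dot x x by rewrite lt_neqAle dot_ge0 eq_sym dot_eq0 x0.
have : dot (rk1 x x x) x = dot (rk1 y y x) x by rewrite E.
rewrite !rk1_form ger0_norm ?dot_ge0 // => xy.
have : dot x x ^+ 2 <= dot x x * dot y y.
  rewrite xy -[dot x x]hdot_norm -[dot y y]hdot_norm -exprMn.
  by rewrite lerXn2r ?nnegrE ?mulr_ge0 ?hdot_CS.
by rewrite expr2 ler_pM2l.
Qed.

Lemma pos_form_gt0 A : pos_op A -> A != 0 -> exists h, 0 < dot (A h) h.
Proof.
move=> pA A0; have [h /eqP h0] : exists h, dot (A h) h <> 0.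
  apply/existsNP => Az; move/eqP: A0; apply; apply: form_inj => h.
  by rewrite Az bop0E dot0l.
by exists h; rewrite lt_neqAle pA eq_sym h0.
Qed.

Definition order_auto (P : BH -> BH) := 
  [/\ linear P, bijective P & forall A, pos_op (P A) <-> pos_op A].

Lemma order_auto_inv P Q : order_auto P -> cancel P Q -> cancel Q P -> order_auto Q.
Proof.
move=> [lP _ pP] PQ QP; split; last by move=> A; rewrite -pP QP.
  by move=> l x y; apply: (can_inj PQ); rewrite lP !QP.
by exists P.
Qed.

(** A rank one [D] below [C] has its preimage below [rk1 h h], hence on the same ray, so [D] is a
    multiple of [C]; their forms agree at [v], so the factor is 1. *)
Lemma order_auto_rk1 P h : order_auto P -> exists k, P (rk1 h h) = rk1 k k.
Proof.
move=> oP; have [lP [Q PQ QP] pP] := oP.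
have [_ _ pQ] := order_auto_inv oP PQ QP.
set C := P _; have pC : pos_op C by apply/pP/pos_rk1.
have [->|C0] := eqVneq C 0.
  by exists 0; apply: bopP => v; rewrite rk1E scaler0.
have [v v0] := pos_form_gt0 pC C0; have := pos_sub_rk1 pC v0.
set a := dot (C v) v in v0 *; set D := a^-1 *: rk1 (C v) (C v) => pCD.
have pD : pos_op D by apply: posZ; [rewrite invr_ge0 ltW | exact: pos_rk1].
have : pos_op (1 *: rk1 h h - Q D).
  by rewrite scale1r; apply/pP; rewrite (linearB_of lP) QP.
move=> /(below_rk1 ((pQ D).2 pD)); set c := _ / _ => QD.
have DE : D = c *: C by rewrite -[D]QP QD (linearZ_of lP).
have c1 : c = 1.
  have : dot (D v) v = c * a by rewrite DE bopZE hdotZl.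
  rewrite bopZE hdotZl rk1_form -(pos_sym v v pC) -/a ger0_norm ?ltW //.
  by rewrite expr2 mulKf ?gt_eqF // => /esym/eqP; rewrite -subr_eq0 -{2}(mul1r a)
     -mulrBl mulf_eq0 (gt_eqF v0) orbF subr_eq0 => /eqP.
exists (sqrtC a^-1 *: C v); rewrite rk1Zl rk1Zr scalerA.
have -> : (sqrtC a^-1)^* = sqrtC a^-1.
  by apply/CrealP; rewrite ger0_real // sqrtC_ge0 invr_ge0 ltW.
by rewrite -expr2 sqrtCK -/D DE c1 scale1r.
Qed.

(** With [n] above the norm of [P 1], the inequalities [(l / n) P 1 <= l 1 <= P A] can be pulled
    back along [P]. *)
Lemma order_auto_unit P A l : order_auto P -> 0 < l -> pos_op (P A - l *: idb) ->
  exists2 m, 0 < m & pos_op (A - m *: idb).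
Proof.
move=> [lP _ pP] l0 pA; pose n := `|P idb| + 1.
have n0 : 0 < n by rewrite ltr_wpDl.
exists (l / n); first by rewrite divr_gt0.
apply/pP; rewrite (linearB_of lP) (linearZ_of lP).
have -> : P A - (l / n) *: P idb = (P A - l *: idb) + (l / n) *: (n *: idb - P idb).
  by rewrite scalerBr scalerA divfK ?gt_eqF // addrA subrK.
apply: posD => //; apply: posZ; first by rewrite divr_ge0 ?ltW.
move=> h; rewrite bopDE bopNE bopZE hdotDl hdotNl hdotZl subr_ge0.
have p1 : pos_op (P idb) by apply/pP => v; exact: dot_ge0.
by apply: le_trans (pos_bound _ p1) _; rewrite ler_wpM2r ?dot_ge0 // lerDl.
Qed.

Definition locally_order_auto (E : BH -> BH) :=
  [/\ linear E, E idb = idb & forall A, exists2 P, order_auto P & E A = P A].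

Lemma locally_order_auto_pos E A : locally_order_auto E -> pos_op A -> pos_op (E A).
Proof. by move=> [_ _ lE] pA; have [P [_ _ pP] ->] := lE A; apply/pP. Qed.

(** Positivity of the image of [m 1 - rk1 h h] gives [|k|^2 <= m]. If this were strict, that image
    would be bounded below by a positive scalar; by [order_auto_unit] so would [m 1 - rk1 h h],
    whose form vanishes at [h]. *)
Lemma locally_order_auto_rk1 E h : locally_order_auto E ->
  exists2 k, E (rk1 h h) = rk1 k k & dot k k = dot h h.
Proof.
move=> lE; have [lin E1 loc] := lE.
have [P oP EP] := loc (rk1 h h); have [k kE] := order_auto_rk1 h oP.
rewrite -EP in kE; exists k => //; set m := dot h h.
have [h0|h0] := eqVneq h 0.
  have := kE; rewrite /m h0.
  have -> : rk1 0 0 = 0 :> BH by apply: bopP => v; rewrite rk1E scaler0.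
  rewrite (linear0_of lin) => /esym k0; have := rk1_form k k.
  rewrite k0 bop0E dot0l => /esym/eqP.
  by rewrite expf_eq0 normr_eq0 /= dot_eq0 => /eqP ->.
have m0 : 0 < m by rewrite lt_neqAle dot_ge0 eq_sym dot_eq0 h0.
have E2 : E (m *: idb - rk1 h h) = m *: idb - rk1 k k.
  by rewrite (linearB_of lin) (linearZ_of lin) E1 kE.
have form z (r : R[i]) v : dot ((r *: idb - rk1 z z) v) v = r * dot v v - `|dot v z| ^+ 2.
  by rewrite bopDE bopNE bopZE hdotDl hdotNl hdotZl rk1_form.
have CS z v : `|dot v z| ^+ 2 <= dot z z * dot v v.
  rewrite -[dot v v]hdot_norm -[dot z z]hdot_norm -exprMn mulrC.
  by rewrite lerXn2r ?nnegrE ?mulr_ge0 ?hdot_CS.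
have ph : pos_op (m *: idb - rk1 h h) by move=> v; rewrite form subr_ge0; exact: CS.
have km : dot k k <= m.
  have := locally_order_auto_pos lE ph k; rewrite E2 form subr_ge0.
  rewrite ger0_norm ?dot_ge0 //.
  have [->|k0] := eqVneq k 0; first by rewrite dot0l (ltW m0).
  by rewrite expr2 ler_pM2r // lt_neqAle dot_ge0 eq_sym dot_eq0 k0.
apply/eqP; rewrite eq_le km /=; apply: contraT => mk.
have {}mk : 0 < m - dot k k.
  by rewrite subr_gt0 lt_neqAle km andbT; apply: contraNN mk => /eqP ->.
have [Q oQ EQ] := loc (m *: idb - rk1 h h).
have [|r r0] := @order_auto_unit Q (m *: idb - rk1 h h) _ oQ mk.
  rewrite -EQ E2 => v; rewrite bopDE bopNE bopZE hdotDl hdotNl hdotZl form.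
  rewrite [X in 0 <= X](_ : _ = dot k k * dot v v - `|dot v k| ^+ 2); last by ring.
  by rewrite subr_ge0; exact: CS.
move=> /(_ h); rewrite bopDE bopNE bopZE hdotDl hdotNl hdotZl form.
rewrite ger0_norm ?dot_ge0 // -/m expr2 subrr sub0r oppr_ge0.
by rewrite lt_geF // mulr_gt0.
Qed.

End OperatorOrder.

(** * An operator detecting positive functionals on rank one operators *)

Section FaithfulOperator.
Variables (R : realType) (H : hilbertType R).
Local Notation dot := (@hdot R H).
Local Notation BH := (boundedop H).
Local Notation idb := (idb H).
Implicit Types (A B : BH) (x y h k v : H) (l m e : R[i]).

Lemma pos_closed A : (forall e, 0 < e -> pos_op (e *: idb + A)) -> pos_op A.
Proof.
move=> pA v; apply/ler_addgt0Pl => e e0.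
have n0 : 0 < dot v v + 1 by rewrite ltr_wpDl ?dot_ge0.
have := pA (e / (dot v v + 1)) (divr_gt0 e0 n0) v.
rewrite bopDE bopZE hdotDl hdotZl => /le_trans; apply; rewrite lerD2r.
by rewrite mulrAC ler_pdivrMr // ler_pM2l // lerDl.
Qed.

Lemma pos_idb_add A e : star A = A -> `|A| <= e -> pos_op (e *: idb + A).
Proof. by move=> sA Ae; apply/pos_op_cpositive/cpositive_shift => //; exact: cunit_idb. Qed.

Lemma norm_rk1 h : `|rk1 h h| <= dot h h.
Proof.
apply: bopnorm_le => [|v]; first exact: dot_ge0.
by rewrite normrZ -hdot_norm expr2 -mulrA mulrC ler_wpM2l // mulrC hdot_CS.
Qed.

Lemma pos_sub_rk1_idb h m : dot h h <= m -> pos_op (m *: idb - rk1 h h).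
Proof.
move=> hm; apply: pos_idb_add; first by rewrite starN (pos_star (pos_rk1 h)).
by rewrite normrN (le_trans (norm_rk1 h)).
Qed.

Lemma dense_sequence : separable_space H ->
  exists d : nat -> H, forall h e, 0 < e -> exists n, `|h - d n| <= e.
Proof.
move=> [D cD dD]; have /countable_injP[f fD] := cD.
(* Numbers that [f] does not attain on [D] get the default value 0. *)
pose d n := xget 0 [set h | D h /\ f h = n].
have dE h : D h -> d (f h) = h.
  move=> Dh; rewrite /d; case: xgetP => [x _ [Dx fx]|/(_ h)]; last by case.
  by apply: fD => //; rewrite inE.
exists d => h e e0.
have [|x [/interior_subset hx Dx]] := dD (ball h e)^° _ (@open_interior _ _).
  by exists h; exact: nbhsx_ballx.
by exists (f x); rewrite dE // ltW //; move: hx; rewrite -ball_normE.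
Qed.

(* [A0] is the sum of the [c_n d_n d_n^*], for [d_n] dense in [H] and [c_n > 0]
   decreasing fast enough. This is the only use of separability. *)
Lemma faithful_operator : separable_space H -> exists A0 : BH, forall w : BH -> R[i],
  linear w -> (forall A, pos_op A -> 0 <= w A) ->
  (w A0 = 0 <-> forall h, w (rk1 h h) = 0).
Proof.
move=> /dense_sequence[d dP].
(* The denominator keeps the norm of [t n] below [2^-1 ^+ n.+1], the increment of [s]. *)
pose c n : R[i] := 2^-1 ^+ n.+1 / (1 + dot (d n) (d n)).
have d1 n : 0 < 1 + dot (d n) (d n) by rewrite ltr_wpDr ?dot_ge0.
have c0 n : 0 < c n by rewrite divr_gt0 // exprn_gt0 // invr_gt0.
pose t n := c n *: rk1 (d n) (d n).
have pt n : pos_op (t n) by apply: posZ (pos_rk1 _); exact: ltW.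
pose u n := \sum_(i < n) t i.
have uS n : u n.+1 = u n + t n by rewrite /u big_ord_recr.
have pu n : pos_op (u n).
  elim: n => [|n IH]; first by move=> v; rewrite /u big_ord0 bop0E dot0l.
  by rewrite uS; exact: posD.
have put n i : (i < n)%N -> pos_op (u n - t i).
  elim: n => // n IH; rewrite ltnS leq_eqVlt uS => /orP[/eqP->|/IH pn].
    by rewrite addrK.
  by rewrite addrAC; exact: posD.
pose s n : R := 1 - 2^-1 ^+ n.
have [n|n|A0 A0P] := @dominated_cvg R BH u s.
- rewrite uS addrC addKr normrZ gtr0_norm //.
  have -> : (s n.+1 - s n)%:C%C = 2^-1 ^+ n.+1.
    rewrite (_ : s n.+1 - s n = 2^-1 ^+ n.+1); last by rewrite /s exprS; field.
    by rewrite rmorphXn fmorphV rmorph_nat.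
  rewrite /c mulrAC ler_pdivrMr // ler_pM2l ?exprn_gt0 ?invr_gt0 //.
  by apply: le_trans (norm_rk1 _) _; rewrite lerDr.
- by rewrite /s lerBlDr lerDl exprn_ge0 // invr_ge0.
have sA0 : star A0 = A0.
  apply/subr0_eq/(norm_le_eps (k := 2)) => e e0.
  have [N /(_ N (leqnn N)) AN] := A0P e e0.
  rewrite mulr2n (le_trans (ler_distD (u N) _ _)) // lerD //; last by rewrite distrC.
  suff -> : star A0 - u N = star (A0 - u N) by rewrite norm_star.
  by rewrite starB (pos_star (pu N)).
have sd n : star (A0 - u n) = A0 - u n by rewrite starB sA0 pos_star.
exists A0 => w lw pw; split=> [wA0 h|wr].
  have wd n : w (rk1 (d n) (d n)) = 0.
    (* The partial sums from index [n.+1] on contain the term [t n], and positivity passes to the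
       limit. *)
    have : pos_op (A0 - t n).
      apply: pos_closed => e e0; have [N NP] := A0P e e0.
      have := pos_idb_add (sd (maxn N n.+1)) (NP _ (leq_maxl _ _)).
      have := put (maxn N n.+1) n (leq_maxr _ _).
      by move=> p1 p2; have := posD p2 p1; rewrite addrA -addrA addrA !addrA subrK.
    move=> /pw; rewrite (linearB_of lw) wA0 sub0r oppr_ge0 (linearZ_of lw).
    rewrite pmulr_rle0 // => w0; apply/le_anti; rewrite w0; exact/pw/pos_rk1.
  apply/le_anti; rewrite [0 <= _](pw _ (pos_rk1 h)) andbT.
  apply/ler_addgt0Pl => e e0; rewrite addr0.
  have wi : 0 <= w idb by apply: pw => v; exact: dot_ge0.
  have n0 : 0 < 2 * w idb + 1 by rewrite ltr_wpDl // mulr_ge0.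
  pose b := e / (2 * w idb + 1); have b0 : 0 < b by rewrite divr_gt0.
  have b10 : 0 < 1 + b by rewrite ltr_wpDl // ltW.
  (* This tolerance is below both [b] and 1, so its square is at most [b]. *)
  have [n hn] := dP h (b / (1 + b)) (divr_gt0 b0 b10).
  set r := h - d n in hn.
  have rb : dot r r <= b.
    rewrite -hdot_norm; apply: (@le_trans _ _ ((b / (1 + b)) ^+ 2)).
      by rewrite lerXn2r ?nnegrE ?divr_ge0 // ltW.
    rewrite expr2 -[leRHS]mulr1 ler_pM ?divr_ge0 // ?ltW //.
      by rewrite ltr_pdivrMr // ltr_pMr // ltrDl.
    by rewrite ltr_pdivrMr // mul1r ltrDr.
  have hE : h = d n + r by rewrite /r addrC subrK.
  (* By the parallelogram law and [wd], [w (rk1 h h)] is at most [2 w (rk1 r r)]. *)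
  have : w (rk1 (d n - r) (d n - r)) =
      2 * w (rk1 (d n) (d n)) + 2 * w (rk1 r r) - w (rk1 h h).
    rewrite hE -scaleN1r !(rk1Dl, rk1Dr, rk1Zl, rk1Zr) rmorphN rmorph1.
    rewrite !(linearD_of lw, linearZ_of lw) /GRing.scale /=; ring.
  rewrite wd mulr0 add0r => wE.
  have := pw _ (pos_rk1 (d n - r)); rewrite wE subr_ge0 => /le_trans; apply.
  have := pw _ (pos_sub_rk1_idb rb); rewrite (linearB_of lw) (linearZ_of lw) subr_ge0.
  move=> wr; apply: (@le_trans _ _ (2 * (b * w idb))); first by rewrite ler_pM2l.
  by rewrite mulrCA /b mulrAC ler_pdivrMr // ler_pM2l // lerDl.
have wu n : w (u n) = 0.
  elim: n => [|n IH]; first by rewrite /u big_ord0 (linear0_of lw).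
  by rewrite uS (linearD_of lw) IH (linearZ_of lw) wr add0r scaler0.
apply/eqP; rewrite -normr_le0; apply/ler_addgt0Pl => e e0; rewrite addr0.
have wi : 0 <= w idb by apply: pw => v; exact: dot_ge0.
have n0 : 0 < 2 * w idb + 1 by rewrite ltr_wpDl // mulr_ge0.
have [N /(_ N (leqnn N)) AN] := A0P (e / (2 * w idb + 1)) (divr_gt0 e0 n0).
rewrite -(subrK (u N) A0) (linearD_of lw) wu addr0.
apply: le_trans (positive_functional_bound (@cunit_idb _ _) lw _ _) _.
  by move=> A /pos_op_cpositive; exact: pw.
rewrite mulrAC mulrC; apply: le_trans (ler_wpM2r _ AN) _; first by rewrite mulr_ge0.
by rewrite mulrAC ler_pdivrMr // ler_pM2l // lerDl.
Qed.

End FaithfulOperator.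

(** * Wigner's argument for unital positive maps preserving rank one operators *)

Section RankOnePreserver.
Variables (R : realType) (H : hilbertType R).
Local Notation dot := (@hdot R H).
Local Notation BH := (boundedop H).
Local Notation idb := (idb H).
Implicit Types (A B : BH) (x y h k v : H) (l m : R[i]).

Variable E : BH -> BH.
Hypothesis linE : linear E.
Hypothesis posE : forall A, pos_op A -> pos_op (E A).
Hypothesis E1 : E idb = idb.
Hypothesis rkE : forall h, exists2 k, E (rk1 h h) = rk1 k k & dot k k = dot h h.

Variables a b : H.
Hypothesis aa : dot a a = 1.
Hypothesis Ea : E (rk1 a a) = rk1 b b.
Hypothesis bb : dot b b = 1.

Let formD A B v : dot ((A + B) v) v = dot (A v) v + dot (B v) v.
Proof. by rewrite bopDE hdotDl. Qed.

Let formZ l A v : dot ((l *: A) v) v = l * dot (A v) v.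
Proof. by rewrite bopZE hdotZl. Qed.

Let formE := (formD, formZ).

(* If [E A = V A V^*] then [V2] vanishes on the orthogonal of [a] and [V1 = V];
   if [E A = V A^* V^*] with [V] conjugate linear, the roles are exchanged. *)
Let V1 h := E (rk1 h a) b.
Let V2 h := E (rk1 a h) b.

Let V1D x y : V1 (x + y) = V1 x + V1 y.
Proof. by rewrite /V1 rk1Dl (linearD_of linE). Qed.

Let V2D x y : V2 (x + y) = V2 x + V2 y.
Proof. by rewrite /V2 rk1Dr (linearD_of linE). Qed.

Let V1Z l x : V1 (l *: x) = l *: V1 x.
Proof. by rewrite /V1 rk1Zl (linearZ_of linE). Qed.

Let V2Z l x : V2 (l *: x) = l^* *: V2 x.
Proof. by rewrite /V2 rk1Zr (linearZ_of linE). Qed.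

Let V1a : V1 a = b.
Proof. by rewrite /V1 Ea rk1E bb scale1r. Qed.

Let V2a : V2 a = b.
Proof. by rewrite /V2 Ea rk1E bb scale1r. Qed.

Let bessel h : dot h a = 0 ->
  pos_op (dot h h *: idb - rk1 h h - dot h h *: rk1 a a).
Proof.
move=> ha v; rewrite !(rk1_form, bopDE, bopNE, bopZE, hdotDl, hdotNl, hdotZl).
have ah : dot a h = 0 by rewrite hdotC ha rmorph0.
pose w := v - dot v a *: a.
have wh : dot w h = dot v h by rewrite hdotDl hdotNl hdotZl ah mulr0 subr0.
have ww : dot w w = dot v v - `|dot v a| ^+ 2.
  rewrite normCK !(hdotDl, hdotDr, hdotNl, hdotNr, hdotZl, hdotZr) aa [dot a v]hdotC.
  ring.
rewrite addrAC -mulrBr -ww -wh subr_ge0 -!hdot_norm -exprMn.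
by rewrite lerXn2r ?nnegrE ?mulr_ge0 // mulrC hdot_CS.
Qed.

(** The image under [E] of the operator in [bessel] has form [- |<b, g>|^2] at [b]. *)
Let image_perp h g : dot h a = 0 -> E (rk1 h h) = rk1 g g -> dot b g = 0.
Proof.
move=> ha hg; have := posE (bessel ha) b.
rewrite !(linearB_of linE, linearZ_of linE) E1 hg Ea.
rewrite !(rk1_form, bopDE, bopNE, bopZE, hdotDl, hdotNl, hdotZl) bb normr1.
rewrite expr1n addrAC subrr sub0r oppr_ge0 => bg.
by apply/normr0_eq0/eqP; rewrite -sqrf_eq0 eq_le bg exprn_ge0.
Qed.

Let K h l := E (rk1 (h + l *: a) (h + l *: a)).

Let KE h l : K h l =
  E (rk1 h h) + l^* *: E (rk1 h a) + l *: E (rk1 a h) + (l * l^*) *: rk1 b b.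
Proof.
rewrite /K !(rk1Dl, rk1Dr, rk1Zl, rk1Zr) !(linearD_of linE, linearZ_of linE) Ea.
by rewrite scalerA -!addrA.
Qed.

Let KbE h l : dot h a = 0 ->
  K h l b = l^* *: V1 h + l *: V2 h + (l * l^*) *: b.
Proof.
move=> ha; have [g hg _] := rkE h.
rewrite KE hg !bopDE !bopZE !rk1E (image_perp ha hg) bb scale0r add0r.
by rewrite scale1r.
Qed.

Let zero_of_ge0 (z : R[i]) : (forall t, 0 < t -> 0 <= z + t) ->
  (forall t, 0 < t -> 0 <= - z + t) -> z = 0.
Proof.
move=> z1 z2; apply/le_anti; apply/andP; split; apply/ler_addgt0Pl => t t0.
  by rewrite addr0 -subr_ge0 addrC z2.
by rewrite addrC z1.
Qed.

(** The form of [K h l] at [b] is a nonnegative quadratic in [l] without constant term, so its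
    linear part vanishes as [l] tends to 0 in each direction; the directions 1 and ['i] suffice. *)
Let V_perp h : dot h a = 0 -> dot (V1 h) b = 0 /\ dot (V2 h) b = 0.
Proof.
move=> ha; set p := dot (V1 h) b; set q := dot (V2 h) b.
have pq l : 0 <= l^* * p + l * q + l * l^*.
  have := posE (pos_rk1 (h + l *: a)) b; rewrite -/(K h l) KbE //.
  by rewrite !(hdotDl, hdotZl) bb mulr1.
have key (m : R[i]) : m * m^* = 1 -> m^* * p + m * q = 0.
  move=> mm; apply: zero_of_ge0 => t t0.
    have := pq (t * m); rewrite rmorphM /= (CrealP (gtr0_real t0)).
    rewrite (_ : _ + _ + _ = t * (m^* * p + m * q + t * (m * m^*))); last by ring.
    by rewrite mm mulr1 pmulr_rge0.
  have := pq (- t * m); rewrite rmorphM rmorphN /= (CrealP (gtr0_real t0)).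
  rewrite (_ : _ + _ + _ = t * (- (m^* * p + m * q) + t * (m * m^*))); last by ring.
  by rewrite mm mulr1 pmulr_rge0.
have k1 : p + q = 0 by have := key 1; rewrite rmorph1 !mul1r; apply.
have : - 'i * p + 'i * q = 0.
  by rewrite -conjCi; apply: key; rewrite conjCi mulrN -expr2 sqrCi opprK.
rewrite mulNr addrC -mulrBr => /eqP; rewrite mulf_eq0 (negPf (neq0Ci _)) /=.
rewrite subr_eq0 => /eqP qp.
have : p *+ 2 = 0 by rewrite mulr2n -{2}qp.
by move=> /eqP; rewrite mulrn_eq0 /= => /eqP p0; rewrite qp p0.
Qed.

Let rk1_apply k : rk1 (rk1 k k b) (rk1 k k b) = dot (rk1 k k b) b *: rk1 k k.
Proof. by rewrite rk1_form !rk1E rk1Zl rk1Zr scalerA normCK. Qed.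

(** [K h l] is some [rk1 k k], hence determined by its value at [b] up to the form there, which is
    [l * l^*] by [V_perp]. *)
Let KK h l : dot h a = 0 ->
  (l * l^*) *: K h l = rk1 (K h l b) (K h l b).
Proof.
move=> ha; have [k kE _] := rkE (h + l *: a).
rewrite {2 3}/K kE rk1_apply -kE -/(K h l) KbE //.
have [V1b V2b] := V_perp ha.
by rewrite !(hdotDl, hdotZl) V1b V2b bb !mulr0 !add0r mulr1.
Qed.

(* Adding up [KK] for [l] and [- l] cancels the mixed terms with [b]. *)
Let KKE h g l : dot h a = 0 -> E (rk1 h h) = rk1 g g ->
  (l * l^*) *: rk1 g g = rk1 (l^* *: V1 h + l *: V2 h) (l^* *: V1 h + l *: V2 h).
Proof.
move=> ha hg; have := KK l ha; have := KK (- l) ha.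
rewrite !KbE // !KE hg rmorphN /= mulrNN.
have -> : - l^* *: V1 h + - l *: V2 h = - (l^* *: V1 h + l *: V2 h).
  by rewrite !scaleNr opprD.
move: (l^* *: V1 h + l *: V2 h) => w.
have : (l * l^*)^* = l * l^* by rewrite rmorphM /= conjCK mulrC.
move: (l * l^*) => c cR.
rewrite -[- w]scaleN1r !(rk1Dl, rk1Dr, rk1Zl, rk1Zr) rmorphN rmorph1 /= cR.
move: (E (rk1 h a)) (E (rk1 a h)) => S T e1 e2; apply: form_inj => v.
have := congr1 (fun A => dot (bop_fun A v) v) e1.
have := congr1 (fun A => dot (bop_fun A v) v) e2.
rewrite !formE => f1 f2.
have : 2 * (c * dot (rk1 g g v) v) = 2 * dot (rk1 w w v) v.
  rewrite (_ : 2 * _ = c * (dot (rk1 g g v) v + l^* * dot (S v) v +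
    l * dot (T v) v + c * dot (rk1 b b v) v) + c * (dot (rk1 g g v) v
    + - l^* * dot (S v) v + - l * dot (T v) v + c * dot (rk1 b b v) v)
    - 2 * (c * (c * dot (rk1 b b v) v))); last by ring.
  by rewrite f1 f2; ring.
by apply: mulfI; rewrite pnatr_eq0.
Qed.

(** [KKE] at [l = 1], ['i] and [1 + 'i], whose squares are [1], [-1] and [2 'i], isolates the cross
    term and shows [rk1 (V1 h) (V2 h) = 0]. *)
Let one_vanishes h g : dot h a = 0 -> E (rk1 h h) = rk1 g g ->
  (V1 h = 0 \/ V2 h = 0) /\ rk1 g g = rk1 (V1 h) (V1 h) + rk1 (V2 h) (V2 h).
Proof.
move=> ha hg.
have := KKE (1 + 'i) ha hg; have := KKE 'i ha hg; have := KKE 1 ha hg.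
move: (V1 h) (V2 h) => v1 v2.
rewrite rmorphD !rmorph1 /= conjCi.
rewrite !(rk1Dl, rk1Dr, rk1Zl, rk1Zr) !rmorphD !rmorphN !rmorph1 /= !conjCi.
move=> e1 e2 e3.
have ii : 'i * 'i = -1 :> R[i] by rewrite -expr2 sqrCi.
have cross : rk1 v1 v2 = 0 /\ rk1 g g = rk1 v1 v1 + rk1 v2 v2.
  have forms v :
    4 * dot (rk1 v1 v2 v) v = 0 /\
    2 * dot (rk1 g g v) v = 2 * (dot (rk1 v1 v1 v) v + dot (rk1 v2 v2 v) v).
    have := congr1 (fun A => dot (bop_fun A v) v) e1.
    have := congr1 (fun A => dot (bop_fun A v) v) e2.
    have := congr1 (fun A => dot (bop_fun A v) v) e3.
    cbv beta; rewrite !formE.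
    move: (dot (rk1 g g v) v) (dot (rk1 v1 v1 v) v) (dot (rk1 v1 v2 v) v).
    move: (dot (rk1 v2 v1 v) v) (dot (rk1 v2 v2 v) v) => q r G s t f3 f2 f1.
    have t4 : 4 * t = (1 * 1 * G - 'i * - 'i * G)
        + 'i * ((1 + 'i) * (1 - 'i) * G) - 'i * (1 * 1 * G + 'i * - 'i * G).
      by rewrite f1 f2 f3; ring: ii.
    have G2 : 1 * 1 * G + 'i * - 'i * G = 2 * (s + r) by rewrite f1 f2; ring: ii.
    by rewrite t4 -G2; split; ring: ii.
  split; apply: form_inj => v; have [v4 v2'] := forms v.
    by rewrite bop0E dot0l; apply/eqP; move/eqP: v4; rewrite mulf_eq0 pnatr_eq0.
  by move: v2'; rewrite -formD; apply: mulfI; rewrite pnatr_eq0.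
have [c1 ->] := cross; split=> //.
have [->|v20] := eqVneq v2 0; [by right | left].
have /eqP : rk1 v1 v2 v2 = 0 by rewrite c1.
by rewrite rk1E scaler_eq0 dot_eq0 (negPf v20) => /eqP.
Qed.

Let split_vec h : exists2 h0, dot h0 a = 0 & h = h0 + dot h a *: a.
Proof.
exists (h - dot h a *: a); last by rewrite subrK.
by rewrite hdotDl hdotNl hdotZl aa mulr1 subrr.
Qed.

(** The orthogonal of [a] is not the union of two proper subspaces: [V2 x <> 0] and [V1 y <> 0]
    contradict [one_vanishes] at [x + y]. *)
Let dichotomy : (forall h, dot h a = 0 -> V2 h = 0) \/
  (forall h, dot h a = 0 -> V1 h = 0).
Proof.
have [|/existsNP[x /not_implyP[xa V2x]]] := pselect (forall h, dot h a = 0 -> V2 h = 0).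
  by left.
right=> y ya; apply: contrapT => V1y.
have one h : dot h a = 0 -> V1 h = 0 \/ V2 h = 0.
  by move=> ha; have [g hg _] := rkE h; have [] := one_vanishes ha hg.
have V1x : V1 x = 0 by have [] := one x xa.
have V2y : V2 y = 0 by have [] := one y ya.
have xya : dot (x + y) a = 0 by rewrite hdotDl xa ya addr0.
by have [] := one _ xya; rewrite ?V1D ?V2D ?V1x ?V2y ?add0r ?addr0.
Qed.

Lemma rank_one_preserver_form : exists (V : H -> H) (s : R[i] -> R[i]),
  [/\ s =1 id \/ s =1 Num.conj, forall x y, V (x + y) = V x + V y,
      forall l x, V (l *: x) = s l *: V x &
      forall h, E (rk1 h h) = rk1 (V h) (V h)].
Proof.
(* For [h = h0 + l a] with [l <> 0] the claim is read off from [KK] after multiplication by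
   [l * l^*]; at [l = 0] that identity is trivial and [one_vanishes] is used instead. *)
have form V : (forall h0 l, dot h0 a = 0 -> (l * l^*) *: K h0 l =
      (l * l^*) *: rk1 (V (h0 + l *: a)) (V (h0 + l *: a))) ->
    (forall h0, dot h0 a = 0 -> E (rk1 h0 h0) = rk1 (V h0) (V h0)) ->
    forall h, E (rk1 h h) = rk1 (V h) (V h).
  move=> V1P V0P h; have [h0 h0a hE] := split_vec h.
  have [l0|l0] := eqVneq (dot h a) 0; first exact: V0P.
  rewrite hE; apply: (@scalerI _ _ (dot h a * (dot h a)^*)) (V1P _ _ h0a).
  by rewrite mulf_neq0 ?conjC_eq0.
have [V20|V10] := dichotomy; [exists V1, id | exists V2, Num.conj]; split => //.
- by left.
- apply: form => [h0 l h0a|h0 h0a].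
    rewrite KK // KbE // V20 // scaler0 addr0 V1D V1Z V1a.
    have -> : l^* *: V1 h0 + (l * l^*) *: b = l^* *: (V1 h0 + l *: b).
      by rewrite scalerDr scalerA mulrC.
    by rewrite rk1Zl rk1Zr scalerA conjCK mulrC.
  have [g hg _] := rkE h0; have [_ gE] := one_vanishes h0a hg.
  rewrite hg gE V20 //; apply: form_inj => v.
  by rewrite formD [X in _ + X]rk1_form dot0r normr0 expr0n addr0.
- by right.
- apply: form => [h0 l h0a|h0 h0a].
    rewrite KK // KbE // V10 // scaler0 add0r V2D V2Z V2a.
    have -> : l *: V2 h0 + (l * l^*) *: b = l *: (V2 h0 + l^* *: b).
      by rewrite scalerDr scalerA.
    by rewrite rk1Zl rk1Zr scalerA.
  have [g hg _] := rkE h0; have [_ gE] := one_vanishes h0a hg.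
  rewrite hg gE V10 //; apply: form_inj => v.
  by rewrite formD [X in X + _]rk1_form dot0r normr0 expr0n add0r.
Qed.

End RankOnePreserver.

(** * Unital maps of [B(H)] that are locally order automorphisms *)

Section LocalOrderAuto.
Variables (R : realType) (H : hilbertType R).
Local Notation dot := (@hdot R H).
Local Notation BH := (boundedop H).
Local Notation idb := (idb H).
Implicit Types (A B : BH) (x y h k v : H) (l m : R[i]).

(** * Linear and conjugate linear isometries *)

Section SemiIsometry.
Variables (V : H -> H) (s : R[i] -> R[i]).
Hypothesis sE : s =1 id \/ s =1 Num.conj.
Hypothesis VD : forall x y, V (x + y) = V x + V y.
Hypothesis VZ : forall l x, V (l *: x) = s l *: V x.
Hypothesis Vnorm : forall x, dot (V x) (V x) = dot x x.

(** Expanding the norm of [V (x + z)] gives real parts of inner products; [z = 'i *: y] gives the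
    imaginary parts, which is where [s] enters. *)
Lemma semi_isometry_dot x y : dot (V x) (V y) = s (dot x y).
Proof.
have re z : dot (V x) (V z) + (dot (V x) (V z))^* = dot x z + (dot x z)^*.
  have := Vnorm (x + z); rewrite VD !(hdotDl, hdotDr) !Vnorm.
  rewrite [dot (V z) (V x)]hdotC [dot z x]hdotC -!addrA => /addrI.
  by rewrite !addrA => /addIr.
have i0 : 'i * 2 != 0 :> R[i] by rewrite mulf_neq0 ?neq0Ci ?pnatr_eq0.
have := re ('i *: y); have {re} := re y; rewrite VZ !hdotZr !rmorphM /= conjCK.
case: sE => sE'; rewrite !sE' ?conjCK !conjCi;
  move: (dot x y) (dot (V x) (V y)) => u z re im; apply: (mulfI i0).
  have -> : 'i * 2 * z = 'i * (z + z^*) - (- 'i * z + 'i * z^*) by ring.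
  by rewrite re im; ring.
have -> : 'i * 2 * z = 'i * (z + z^*) + ('i * z + - 'i * z^*) by ring.
by rewrite re im /=; ring.
Qed.

Lemma semi_isometry_sK l : s (s l) = l.
Proof. by case: sE => sE'; rewrite !sE' // conjCK. Qed.

Lemma semi_isometry_s_ge0 l : (0 <= s l) = (0 <= l).
Proof. by case: sE => sE'; rewrite !sE' ?conjC_ge0. Qed.

Lemma semi_isometry_norm_s l : `|s l| = `|l|.
Proof. by case: sE => sE'; rewrite !sE' ?norm_conjC. Qed.

Lemma semi_isometry_inj x y : V x = V y -> x = y.
Proof.
move=> Vxy; apply/subr0_eq/eqP; rewrite -dot_eq0 -Vnorm VD -scaleN1r VZ Vxy.
have -> : s (-1) = -1 by case: sE => sE'; rewrite sE' // rmorphN rmorph1.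
by rewrite scaleN1r subrr dot0l.
Qed.

(** The functional [s <V h, k>] is linear and bounded, hence represented by some [y], and [k - V y]
    is orthogonal to the range of [V]. *)
Lemma semi_isometry_onto : (forall g, (forall h, dot (V h) g = 0) -> g = 0) ->
  forall k, exists h, V h = k.
Proof.
move=> V0 k; have [||x|y yP] := @riesz _ _ (fun h => s (dot (V h) k)) `|k|.
- by move=> x y; rewrite VD hdotDl; case: sE => sE'; rewrite !sE' // rmorphD.
- by move=> l x; rewrite VZ hdotZl; case: sE => sE'; rewrite !sE' // rmorphM /= conjCK.
- rewrite semi_isometry_norm_s (le_trans (hdot_CS _ _)) // mulrC ler_wpM2l //.
  by rewrite -(@ler_pXn2r _ 2) ?nnegrE // !hdot_norm Vnorm.
exists y; apply/esym/subr0_eq/V0 => h.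
by rewrite hdotDr hdotNr semi_isometry_dot -yP semi_isometry_sK subrr.
Qed.

End SemiIsometry.

Lemma locally_order_auto_bij (E : BH -> BH) (e : H) : separable_space H -> e != 0 ->
  locally_order_auto E ->
  (forall B, exists A, E A = B) /\ forall A, `|A| <= 2 * `|E A|.
Proof.
move=> sepH e0 lE; have [linE E1 loc] := lE.
have posE A : pos_op A -> pos_op (E A) by exact: locally_order_auto_pos.
have rkE h := locally_order_auto_rk1 h lE.
pose a := `|e|^-1 *: e.
have aa : dot a a = 1.
  by rewrite -hdot_norm normrZ normfV normr_id mulVf ?expr1n // normr_eq0.
have [b Ea bb] := rkE a; rewrite aa in bb.
have [V [s [sE VD VZ EV]]] := rank_one_preserver_form linE posE E1 rkE aa Ea bb.
have Vnorm x : dot (V x) (V x) = dot x x.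
  by have [k kE <-] := rkE x; apply: rk1_normr_eq; rewrite -EV.
have Vdot := semi_isometry_dot sE VD VZ Vnorm.
have [A0 A0P] := faithful_operator sepH.
(* The functional [<E A g, g>] vanishes on all [rk1 h h], hence at [A0]. There [E] agrees with an
   order automorphism [P], so [<P A g, g>] vanishes on all [rk1 h h] too, one of which [P] sends to
   [rk1 g g]. *)
have V0 g : (forall h, dot (V h) g = 0) -> g = 0.
  move=> Vg; have lw : linear (fun A => dot (E A g) g).
    by move=> l A B; rewrite linE; exact: form_linear.
  have [_] := A0P _ lw (fun A pA => posE A pA g).
  have wr h : dot (E (rk1 h h) g) g = 0.
    by rewrite EV rk1E hdotZl Vg mulr0.
  move=> /(_ wr); have [P oP ->] := loc A0; have [lP bP pP] := oP.
  have lw' : linear (fun A => dot (P A g) g).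
    by move=> l A B; rewrite lP; exact: form_linear.
  have pw' A : pos_op A -> 0 <= dot (P A g) g by move=> /pP; apply.
  have [+ _] := A0P _ lw' pw' => /[apply] Pg.
  have [Q PQ QP] := bP; have [h hE] := order_auto_rk1 g (order_auto_inv oP PQ QP).
  have := Pg h; rewrite -hE QP rk1_form => /eqP.
  by rewrite sqrf_eq0 normr_eq0 dot_eq0 => /eqP.
have Vonto := semi_isometry_onto sE VD VZ Vnorm V0.
(* For [A >= 0], subtracting the rank one operator of [pos_sub_rk1], whose image is known, gives one
   inequality; the same for [|A| 1 - A] gives the other. *)
have key A h : dot (E A (V h)) (V h) = dot (A h) h.
  move: A; apply: (linear_cpositive_ext (@cunit_idb _ _)).
  - by move=> l A B; rewrite linE; exact: form_linear.
  - exact: form_linear.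
  have ge A : pos_op A -> dot (A h) h <= dot (E A (V h)) (V h).
    move=> pA; have [Ah0|Ah0] := eqVneq (dot (A h) h) 0.
      by rewrite Ah0; apply: posE.
    have a0 : 0 < dot (A h) h by rewrite lt_neqAle pA eq_sym Ah0.
    have := posE _ (pos_sub_rk1 pA a0) (V h).
    rewrite (linearB_of linE) (linearZ_of linE) EV bopDE bopNE bopZE.
    rewrite hdotDl hdotNl hdotZl rk1_form Vdot semi_isometry_norm_s //.
    rewrite -(pos_sym h h pA) ger0_norm ?pA // expr2 mulKf ?Ah0 //.
    by rewrite subr_ge0.
  move=> A /pos_op_cpositive pA; apply/le_anti; rewrite ge // andbT.
  have := ge (`|A| *: idb - A).
  rewrite (linearB_of linE) (linearZ_of linE) E1 !bopDE !bopNE !bopZE.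
  rewrite !hdotDl !hdotNl !hdotZl Vnorm lerD2l lerN2; apply=> v.
  by rewrite bopDE bopNE bopZE hdotDl hdotNl hdotZl subr_ge0 pos_bound.
split; last first.
  move=> A; apply: numeric_radius => // h; rewrite -key.
  apply: le_trans (hdot_CS _ _) _.
  rewrite -(Vnorm h) -hdot_norm expr2 mulrA ler_wpM2r //; exact: bopnorm_ub.
apply: (linear_cpositive_surj (@cunit_idb _ _) linE) => B /pos_op_cpositive pB.
(* The preimage of [B] is [V^-1 B V]. For positive [B] its form is real, so this also serves when
   [V] is conjugate linear. *)
pose W k := projT1 (cid (Vonto k)).
have VW k : V (W k) = k by rewrite /W; case: cid.
have Vinj := semi_isometry_inj sE VD VZ Vnorm.
have Alin : bounded_linear (fun h => W (B (V h))).
  split=> [l x y|].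
    by apply: Vinj; rewrite [RHS]VD VZ !VW VD VZ bopD bopZ.
  exists `|B| => x.
  have nV y : `|V y| = `|y|.
    by apply/eqP; rewrite -(@eqrXn2 _ 2) // !hdot_norm Vnorm eqxx.
  by rewrite -[X in X <= _]nV VW -(nV x) bopnorm_ub.
exists (BoundedOp Alin); apply: form_inj => k; have [h <-] := Vonto k.
rewrite key; have := Vdot (W (B (V h))) h; rewrite VW => ->.
have := pB (V h); rewrite -{1}(VW (B (V h))) Vdot semi_isometry_s_ge0 // => Ah.
by case: sE => sE'; rewrite sE' // (CrealP (ger0_real Ah)).
Qed.

End LocalOrderAuto.

(** * Continuous functions on a compact Hausdorff space *)

Section ContinuousFunctions.
Variables (R : realType) (X : compactHausdorffType).
Local Notation CX := (cont_space X R[i]).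
Implicit Types (f g : CX) (x y : X).

Lemma cfunD (V : normedModType R[i]) (F G : cont_space X V) x :
  cont_fun (F + G) x = F x + G x.
Proof. by []. Qed.

Lemma cfunB (V : normedModType R[i]) (F G : cont_space X V) x :
  cont_fun (F - G) x = F x - G x.
Proof. by []. Qed.

Lemma cfunZ (V : normedModType R[i]) (l : R[i]) (F : cont_space X V) x :
  cont_fun (l *: F) x = l *: F x.
Proof. by []. Qed.

Lemma cconst_subproof (V : normedModType R[i]) (v : V) : continuous (fun _ : X => v).
Proof. by move=> x; exact: cvg_cst. Qed.

Definition cconst (V : normedModType R[i]) (v : V) : cont_space X V :=
  mkcont (@cconst_subproof V v).

Lemma cscale_subproof (V : normedModType R[i]) f (F : cont_space X V) :
  continuous (fun x => f x *: F x).
Proof. by move=> x; apply: cvgZ; exact: cont_continuous. Qed.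

Definition cscale (V : normedModType R[i]) f (F : cont_space X V) : cont_space X V :=
  mkcont (@cscale_subproof V f F).

Lemma cscale_mulE f g x : cont_fun (cscale f g) x = f x * g x.
Proof. by []. Qed.

Lemma cnorm_subproof (V : normedModType R[i]) (F : cont_space X V) :
  continuous (fun x => `|F x| : R[i]).
Proof. by move=> x; apply: cvg_norm; exact: cont_continuous. Qed.

Definition cnorm (V : normedModType R[i]) (F : cont_space X V) : CX :=
  mkcont (@cnorm_subproof V F).

Lemma cinv_subproof f : (forall x, f x != 0) -> continuous (fun x => (f x)^-1).
Proof. by move=> f0 x; apply: cvgV => //; exact: cont_continuous. Qed.

Definition cinv f (f0 : forall x, f x != 0) : CX := mkcont (@cinv_subproof f f0).

Lemma cunit_cconst (A : cstarType R) (e : A) : cunital e -> cunital (cconst e).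
Proof.
move=> [el er se e1]; split.
- by move=> F; apply: contP => x; exact: el.
- by move=> F; apply: contP => x; exact: er.
- by apply: contP => x; exact: se.
- by apply: contnorm_le.
Qed.

Lemma cunit1 : cunital (1 : R[i]).
Proof.
split; [exact: mul1r | exact: mulr1 | exact: rmorph1 | by rewrite normr1].
Qed.

Definition cont1 : CX := @cconst R[i] 1.

Lemma cunit_cont1 : cunital cont1.
Proof. exact: cunit_cconst cunit1. Qed.

Lemma cont1E x : cont1 x = 1. Proof. by []. Qed.

Lemma sub_cont1E f (l : R[i]) x : cont_fun (f - l *: cont1) x = f x - l.
Proof. by suff : f x - l * 1 = f x - l by []; rewrite mulr1. Qed.

Lemma cpositive_fun f : cpositive f <-> forall x, 0 <= f x.
Proof.
split=> [[g ->] x|f0].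
  by rewrite [leRHS](_ : _ = (g x)^* * g x) // mulrC -normCK exprn_ge0.
have sf : star f = f.
  by apply: contP => x; apply/CrealP/ger0_real.
apply: (cpositive_scaled cunit_cont1 sf).
apply: contnorm_le => // x; suff : `| `|f| * 1 - f x| <= `|f| by []; rewrite mulr1.
have fx : f x <= `|f| by rewrite -[leLHS]ger0_norm // contnorm_ub.
by rewrite ger0_norm ?subr_ge0 // lerBlDr lerDl.
Qed.

Lemma urysohn_point x (U : set X) : nbhs x U ->
  exists2 f : CX, f x = 0 & forall y, ~ U y -> f y = 1.
Proof.
move=> /nbhs_interior xU; have oU := @open_interior _ U.
have nX : normal_space X by apply: compact_normal; [exact: hausdorffT | exact: compactT].
have cx : closed [set x].
  by apply: accessible_closed_set1; apply: hausdorff_accessible; exact: hausdorffT.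
have xU0 : [set x] `&` ~` U^° = set0.
  by rewrite -subset0 => y /= [->]; apply; exact: nbhs_singleton xU.
have := (@normal_separatorP R X).1 nX [set x] (~` U^°) cx (open_closedC oU) xU0.
move=> /(@uniform_separatorP _ R)[f [cf _ f0 f1]].
have cg : continuous (fun y => (f y)%:C%C : R[i]).
  move=> y; apply/cvgrPdist_lt => e e0.
  have eE : (Re e)%:C%C = e by rewrite RRe_real // gtr0_real.
  have Re0 : 0 < Re e by rewrite -ltcR eE.
  have /cvgrPdist_lt/(_ _ Re0) := cf y.
  apply: filterS => z yz; rewrite -rmorphB /= -eE.
  by rewrite normc_def /= expr0n addr0 sqrtr_sqr ltcR.
exists (mkcont cg) => [|y Uy]; rewrite mkcontE.
  by rewrite (f0 (f x)) //; exists x.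
by rewrite (f1 (f y)) //; exists y => //= /interior_subset; exact: Uy.
Qed.

(** * Unital order automorphisms of [C(X)] followed by evaluation *)

Section Gelfand.
Variable Th : CX -> CX.
Hypothesis oTh : order_automorphisms Th.
Hypothesis Th1 : Th (cont1) = cont1.

Let Th_ge0 f : (forall x, 0 <= f x) <-> (forall x, 0 <= Th f x).
Proof. by have [_ _ p] := oTh; rewrite -!cpositive_fun p. Qed.

(* The zero sets of the [f >= 0] with [Th f x = 0] have the finite intersection
   property, and [y] is in all of them. *)
Lemma unital_order_automorphism_eval x : exists y, forall f, Th f x = f y.
Proof.
have [lin [Ti TK KT] _] := oTh.
have [lTi _ _] := order_automorphisms_inv oTh TK KT.
pose N := [set f : CX | (forall y, 0 <= f y) /\ Th f x = 0].
pose F := filter_from N (fun f : CX => [set y | f y = 0]).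
have FF : ProperFilter F.
  apply: filter_from_proper; last first.
    move=> f [f0 fx]; apply: contrapT => /forallNP fN.
    (* Without zeros [f] is at least [n^-1], hence so is [Th f], against [Th f x = 0]. *)
    have fN0 y : f y != 0 by apply/eqP/fN.
    pose g := cinv fN0; pose n := `|g| + 1.
    have n0 : 0 < n by rewrite ltr_wpDl.
    have fn y : n^-1 <= f y.
      have fy0 : 0 < f y by rewrite lt_neqAle f0 eq_sym fN0.
      rewrite -[f y]invrK lef_pV2 ?posrE ?invr_gt0 // /n.
      have := contnorm_ub g y; rewrite mkcontE ger0_norm ?invr_ge0 // => /le_trans.
      by apply; rewrite lerDl.
    have := (Th_ge0 (f - n^-1 *: cont1)).1.
    have fc y : 0 <= cont_fun (f - n^-1 *: cont1) y.
      by rewrite sub_cont1E subr_ge0.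
    move=> /(_ fc x); rewrite (linearB_of lin) (linearZ_of lin) Th1.
    rewrite sub_cont1E fx sub0r oppr_ge0.
    by rewrite invr_le0 lt_geF.
  apply: filter_from_filter; first by exists 0; split=> //; rewrite (linear0_of lin).
  move=> f g [f0 fx] [g0 gx]; exists (f + g).
    split=> [y|]; first by rewrite cfunD addr_ge0.
    by rewrite (linearD_of lin) cfunD fx gx addr0.
  move=> y fgy; have /eqP : f y + g y = 0 by exact: fgy.
  by rewrite paddr_eq0 // => /andP[/eqP fy /eqP gy]; split.
have [y [_ yF]] := @compactT X F FF filterT.
have Ny f : N f -> f y = 0.
  move=> Nf; apply: contrapT => fy.
  have Ff : F [set y | f y = 0] by exists f.
  have nf : nbhs y [set z | f z != 0].
    by apply: (cvgr_neq0 _ (@cont_continuous _ _ _ f y)); apply/eqP.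
  have [z [/= fz /eqP]] := yF _ _ Ff nf.
  by rewrite fz.
have pos f : (forall z, 0 <= f z) -> Th f x = 0 -> f y = 0 by move=> f0 fx; exact: Ny.
have pTh f : (forall z, 0 <= f z) -> forall z, 0 <= Th f z by move=> /Th_ge0.
have pTi f : (forall z, 0 <= f z) -> forall z, 0 <= Ti f z.
  by move=> f0; apply/Th_ge0 => z; rewrite KT.
have le_cnorm f z : f z \is Num.real -> 0 <= cnorm f z - f z /\ 0 <= cnorm f z + f z.
  move=> fz; rewrite subr_ge0 -[X in _ + X]opprK subr_ge0.
  by rewrite real_ler_norm // mkcontE -normrN real_ler_norm // rpredN.
(* From [|f| <= Th^-1 |Th f|] follows [Th |f| x <= |Th f x| = 0], so that [pos] applies to [|f|]. *)
have real f : (forall z, f z \is Num.real) -> Th f x = 0 -> f y = 0.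
  move=> fR fx; apply/normr0_eq0; change (cnorm f y = 0); apply: pos.
    by move=> z; rewrite mkcontE.
  have ThR z : Th f z \is Num.real.
    have : 0 <= Th (cnorm f + f) z.
      by apply: pTh => t; rewrite cfunD; have [] := le_cnorm f t (fR t).
    have : 0 <= Th (cnorm f) z by apply: pTh => t; rewrite mkcontE.
    rewrite (linearD_of lin) cfunD => /ger0_real r1 /ger0_real r2.
    by rewrite -[Th f z](addKr (Th (cnorm f) z)) rpredD // rpredN.
  set w := cnorm (Th f).
  have p1 z : 0 <= Ti w z - f z.
    have := pTi (w - Th f); rewrite (linearB_of lTi) TK => pw; rewrite -cfunB.
    apply: pw => t.
    by rewrite cfunB; have [] := le_cnorm (Th f) t (ThR t).
  have p2 z : 0 <= Ti w z + f z.
    have := pTi (w + Th f); rewrite (linearD_of lTi) TK => pw; rewrite -cfunD.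
    apply: pw => t.
    by rewrite cfunD; have [] := le_cnorm (Th f) t (ThR t).
  have p3 z : 0 <= cont_fun (Ti w - cnorm f) z.
    rewrite cfunB mkcontE subr_ge0 real_ler_norml //; apply/andP; split.
      by rewrite -subr_ge0 opprK addrC p2.
    by rewrite -subr_ge0 p1.
  have := pTh _ p3 x; rewrite (linearB_of lin) KT cfunB mkcontE fx normr0 sub0r.
  rewrite oppr_ge0 => p4; apply/le_anti; rewrite p4 pTh // => z.
  by rewrite mkcontE.
exists y; apply: (@linear_cpositive_ext _ _ R[i] _ (fun f => Th f x)
  (fun f : CX => f y) cunit_cont1).
- by move=> l f g; rewrite lin.
- by move=> l f g.
move=> f /cpositive_fun f0; have fx : Th f x \is Num.real by rewrite ger0_real // pTh.
apply/esym/eqP; rewrite -subr_eq0 -sub_cont1E; apply/eqP/real => [z|].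
  by rewrite sub_cont1E rpredB // ger0_real.
by rewrite (linearB_of lin) (linearZ_of lin) Th1 sub_cont1E subrr.
Qed.

End Gelfand.
End ContinuousFunctions.

(** * The homeomorphism inducing a unital order automorphism of [C(X)] *)

Section Homeomorphism.
Variables (R : realType) (X : compactHausdorffType).
Local Notation CX := (cont_space X R[i]).
Local Notation cont1 := (cont1 R X).
Implicit Types (f g : CX) (x y : X).

Lemma functions_separate x y : (forall f, f x = f y) -> x = y.
Proof.
move=> fxy; apply: contrapT => xy.
have cy : closed [set y].
  by apply: accessible_closed_set1; apply: hausdorff_accessible; exact: hausdorffT.
have nx : nbhs x (~` [set y]) by apply: open_nbhs_nbhs; split; [exact: closed_openC|].
have [f fx fy] := @urysohn_point R X x _ nx.
have f1 : f y = 1 by apply: fy => /(_ erefl).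
by have := fxy f; rewrite fx f1 => /eqP; rewrite eq_sym oner_eq0.
Qed.

(** [X] carries the initial topology of [C(X)]: for the Urysohn function [f], [|f (p y)| < 1]
    already puts [p y] in [U]. *)
Lemma continuous_of_functions (p : X -> X) :
  (forall f, exists g, forall x, f (p x) = g x) -> continuous p.
Proof.
move=> fp x U /(@urysohn_point R X)[f fx fU].
have [g gE] := fp f.
have /cvgrPdist_lt/(_ 1 ltr01) := @cont_continuous _ _ _ g x.
apply: filterS => y; rewrite -!gE fx sub0r normrN => fy1.
by apply: contrapT => /fU fy; rewrite fy normr1 ltxx in fy1.
Qed.

Lemma unital_order_auto_homeo (Th : CX -> CX) : order_automorphisms Th ->
  Th cont1 = cont1 -> exists p q : X -> X,
  [/\ cancel p q, cancel q p, continuous p, continuous q &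
      forall f x, Th f x = f (p x)].
Proof.
move=> oT T1.
have [Ti [TK KT]] : exists Ti : CX -> CX, cancel Th Ti /\ cancel Ti Th.
  by have [_ [Ti TK KT] _] := oT; exists Ti.
have oTi := order_automorphisms_inv oT TK KT.
have Ti1 : Ti cont1 = cont1 by rewrite -{1}T1 TK.
pose p x := projT1 (cid (unital_order_automorphism_eval oT T1 x)).
have pE f x : Th f x = f (p x) by rewrite /p; case: cid => y /= ->.
pose q x := projT1 (cid (unital_order_automorphism_eval oTi Ti1 x)).
have qE f x : Ti f x = f (q x) by rewrite /q; case: cid => y /= ->.
exists p, q; split=> //.
- by move=> x; apply: functions_separate => f; rewrite -qE -pE KT.
- by move=> x; apply: functions_separate => f; rewrite -pE -qE TK.
- by apply: continuous_of_functions => f; exists (Th f).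
- by apply: continuous_of_functions => f; exists (Ti f).
Qed.

End Homeomorphism.

(** * Positive maps on [C(X, B(H))] and their fibres *)

Section OperatorFunctions.
Variables (R : realType) (X : compactHausdorffType) (H : hilbertType R).
Local Notation dot := (@hdot R H).
Local Notation BH := (boundedop H).
Local Notation CX := (cont_space X R[i]).
Local Notation CXB := (cont_space X BH).
Local Notation cont1 := (cont1 R X).
Implicit Types (f g : CX) (F G : CXB) (A B : BH) (x y : X) (l m : R[i]).

Definition cont_idb : CXB := cconst X (idb H).

Lemma cunit_cont_idb : cunital cont_idb.
Proof. exact: cunit_cconst (@cunit_idb _ _). Qed.

Definition pos_fun F := forall x, pos_op (F x).

Lemma pos_fun_cpositive F : pos_fun F <-> cpositive F.
Proof.
split=> [pF|[G ->] x].
  have sF : star F = F by apply: contP => x; exact: pos_star (pF x).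
  apply: (cpositive_scaled cunit_cont_idb sF).
  apply: contnorm_le => // x; suff : `| `|F| *: idb H - F x| <= `|F| by [].
  by apply: pos_norm_compl => //; exact: contnorm_ub.
by apply/pos_op_cpositive; exists (G x).
Qed.

Lemma cconst_linear : linear (fun A => cconst X A : CXB).
Proof. by move=> l A B; exact: contP. Qed.

Lemma cscale_linear_l F : linear (fun f => cscale f F : CXB).
Proof.
move=> l f g; apply: contP => x.
suff : (l * f x + g x) *: F x = l *: (f x *: F x) + g x *: F x by [].
by rewrite scalerDl scalerA.
Qed.

Lemma cscale_linear f : linear (fun F => cscale f F : CXB).
Proof.
move=> l F G; apply: contP => x.
suff : f x *: (l *: F x + G x) = l *: (f x *: F x) + f x *: G x by [].
by rewrite scalerDr !scalerA mulrC.
Qed.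

Lemma pos_cscale f F : (forall x, 0 <= f x) -> pos_fun F -> pos_fun (cscale f F).
Proof. by move=> f0 pF x; rewrite mkcontE; exact: posZ. Qed.

Lemma pos_cont_idb : pos_fun cont_idb.
Proof. by move=> x v; exact: dot_ge0. Qed.

Lemma pos_cconst A : pos_op A -> pos_fun (cconst X A).
Proof. by move=> pA x. Qed.

Section Vanishing.
Variable L : CXB -> CXB.
Hypothesis linL : linear L.
Hypothesis posL : forall F, pos_fun F -> pos_fun (L F).
Variables x y : X.
Hypothesis L0 : forall f, (forall z, 0 <= f z) -> f y = 0 -> L (cscale f cont_idb) x = 0.

Let vanish_pos F : pos_fun F -> F y = 0 -> L F x = 0.
Proof.
move=> pF Fy; have n0 : L (cscale (cnorm F) cont_idb) x = 0.
  by apply: L0 => [z|]; rewrite mkcontE ?Fy ?normr0.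
apply: form_inj => v; rewrite bop0E dot0l; apply/le_anti; rewrite (posL pF) andbT.
have := posL (F := cscale (cnorm F) cont_idb - F); rewrite (linearB_of linL).
move=> /(_ _ x v); rewrite cfunB n0 sub0r bopNE hdotNl oppr_ge0; apply=> z w.
rewrite cfunB !mkcontE bopDE bopNE bopZE hdotDl hdotNl hdotZl subr_ge0.
exact: pos_bound.
Qed.

(** A self-adjoint [G] with [G y = 0] is the difference of [|G| 1 + G] and [|G| 1], with [|G|] the
    pointwise norm. Both are positive and vanish at [y], and a positive function lies below its
    pointwise norm times the identity, where [L0] applies. *)
Lemma positive_map_vanish F : F y = 0 -> L F x = 0.
Proof.
have [U [W [-> sU sW _ _]]] := star_decomposition F => UW0.
have UW : U y + 'i *: W y = 0 := UW0.
have sUy : star (U y) = U y by rewrite -contstarE sU.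
have sWy : star (W y) = W y by rewrite -contstarE sW.
have Uy : U y = 0.
  have UE : U y = - ('i *: W y) by apply/eqP; rewrite -addr_eq0 UW.
  have : U y = 'i *: W y.
    by rewrite -[LHS]sUy UE starN starZ sWy conjCi scaleNr opprK.
  move=> UE'; have : U y *+ 2 = 0 by rewrite mulr2n {1}UE UE' addNr.
  by rewrite -scaler_nat => /eqP; rewrite scaler_eq0 pnatr_eq0 /= => /eqP.
have Wy : W y = 0.
  by move: UW; rewrite Uy add0r => /eqP; rewrite scaler_eq0 (negPf (neq0Ci _)) /= => /eqP.
have sa (G : CXB) : star G = G -> G y = 0 -> L G x = 0.
  move=> sG Gy; pose n := cscale (cnorm G) cont_idb.
  have GE : G = (n + G) - n by rewrite addrC addKr.
  have ny : n y = 0 by rewrite mkcontE mkcontE Gy normr0 scale0r.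
  rewrite GE (linearB_of linL) cfunB !vanish_pos ?subrr // ?cfunD ?Gy ?ny ?addr0 //.
    by move=> z; apply: pos_cscale => // t; rewrite mkcontE.
  move=> z; rewrite cfunD !mkcontE; apply: pos_idb_add => //.
  by rewrite -contstarE sG.
by rewrite (linearD_of linL) (linearZ_of linL) cfunD cfunZ !sa // scaler0 addr0.
Qed.

Lemma positive_map_fiber F : L F x = L (cconst X (F y)) x.
Proof.
apply/subr0_eq; rewrite -cfunB -(linearB_of linL); apply: positive_map_vanish.
by rewrite cfunB mkcontE subrr.
Qed.

End Vanishing.

(** By extremality [E] multiplies each [rk1 h h] by a scalar. As [E] kills at [h] any positive
    operator whose form vanishes at [h], subtracting a rank one operator from [A] computes
    [E A h]. *)
Lemma order_bounded_scalar (E : BH -> BH) l : linear E ->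
  (forall A, pos_op A -> pos_op (E A) /\ pos_op (l *: A - E A)) ->
  forall e, dot e e = 1 -> forall A, E A = dot (E (idb H) e) e *: A.
Proof.
move=> lE Ele e ee.
have kill A h : pos_op A -> dot (A h) h = 0 -> E A h = 0.
  move=> pA Ah; have [p1 p2] := Ele _ pA; apply: pos_ker => //.
  apply/le_anti; rewrite p1 andbT; have := p2 h.
  by rewrite bopDE bopNE bopZE hdotDl hdotNl hdotZl Ah mulr0 sub0r oppr_ge0.
have rkE h : exists c, E (rk1 h h) = c *: rk1 h h.
  have [p1 p2] := Ele _ (pos_rk1 h).
  by exists (dot (E (rk1 h h) h) h / dot h h ^+ 2); exact: below_rk1 p1 p2.
have loc A h c : pos_op A -> E (rk1 (A h) (A h)) = c *: rk1 (A h) (A h) ->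
    E A h = c *: A h.
  move=> pA cE; have [Ah0|Ah0] := eqVneq (dot (A h) h) 0.
    by rewrite kill // (pos_ker pA Ah0) scaler0.
  have a0 : 0 < dot (A h) h by rewrite lt_neqAle pA eq_sym Ah0.
  have := kill _ h (pos_sub_rk1 pA a0).
  rewrite bopDE bopNE bopZE hdotDl hdotNl hdotZl rk1_form -(pos_sym h h pA).
  rewrite ger0_norm ?pA // expr2 mulKf // subrr => /(_ erefl).
  rewrite (linearB_of lE) (linearZ_of lE) cE bopDE bopNE !bopZE rk1E.
  rewrite -(pos_sym h h pA) !scalerA mulrAC mulVf // mul1r.
  by move=> /subr0_eq.
have p1 : pos_op (idb H) by move=> v; exact: dot_ge0.
set M := E (idb H).
have Me h c : E (rk1 h h) = c *: rk1 h h -> M h = c *: h by exact: loc p1.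
have [c cE] := rkE e; have Mee := Me _ _ cE.
have -> : dot (M e) e = c by rewrite Mee hdotZl ee mulr1.
have e0 : e != 0 by rewrite -dot_eq0 ee oner_eq0.
(* The eigenvalues of [M] at [h] and [h + e] can differ only if [h] is a multiple of [e]. *)
have Mc h : M h = c *: h.
  have [ch chE] := rkE h; have [d dE] := rkE (h + e).
  have := Me _ _ dE; rewrite bopD Mee (Me _ _ chE) scalerDr => /eqP.
  rewrite -subr_eq0 opprD addrACA -!scalerBl => /eqP hd.
  have [dc|dc] := eqVneq ch d.
    move: hd; rewrite dc subrr scale0r add0r => /eqP.
    by rewrite scaler_eq0 (negPf e0) orbF subr_eq0 => /eqP ->.
  have hE : h = ((ch - d)^-1 * (d - c)) *: e.
    have cd : ch - d != 0 by rewrite subr_eq0.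
    apply: (scalerI cd); rewrite scalerA mulVKf //; apply/eqP.
    by rewrite -subr_eq0 -scaleNr opprB hd.
  by rewrite -(Me _ _ chE) hE bopZ Mee !scalerA mulrC.
have rkc h : E (rk1 h h) = c *: rk1 h h.
  have [ch chE] := rkE h; have := Me _ _ chE; rewrite Mc => /eqP.
  rewrite -subr_eq0 -scalerBl scaler_eq0 subr_eq0 => /orP[/eqP ->//|/eqP h0].
  have -> : rk1 h h = 0 by apply: bopP => v; rewrite rk1E h0 scaler0.
  by rewrite (linear0_of lE) scaler0.
apply: (linear_cpositive_ext (@cunit_idb _ _) lE).
  by move=> l' A B; rewrite scalerDr !scalerA mulrC.
by move=> A /pos_op_cpositive pA; apply: bopP => h; apply: loc.
Qed.

End OperatorFunctions.

(** * The action of an order automorphism on scalar functions and on fibres *)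

Section Center.
Variables (R : realType) (X : compactHausdorffType) (H : hilbertType R).
Local Notation dot := (@hdot R H).
Local Notation BH := (boundedop H).
Local Notation CX := (cont_space X R[i]).
Local Notation CXB := (cont_space X BH).
Local Notation cont1 := (cont1 R X).
Local Notation cont_idb := (cont_idb X H).
Implicit Types (f g : CX) (F G : CXB) (A B : BH) (x y : X) (l m : R[i]).

Lemma order_automorphism_pos (S : CXB -> CXB) F : order_automorphisms S ->
  pos_fun (S F) <-> pos_fun F.
Proof. by move=> [_ _ pS]; rewrite !pos_fun_cpositive. Qed.

(** The functionals [<S F x h, h>] are positive; one factor 2 comes from
    [positive_functional_bound], the other from [numeric_radius]. *)
Lemma order_automorphism_bounded (S : CXB -> CXB) :
  order_automorphisms S -> bounded_linear S.
Proof.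
move=> oS; have [lS _ _] := oS; split=> //.
exists (2 * (2 * `|S cont_idb|)) => F.
apply: contnorm_le => [|x]; first by rewrite !mulr_ge0.
rewrite -!mulrA [_ * `|F|]mulrC; apply: numeric_radius => [|h]; first by rewrite !mulr_ge0.
have lw : linear (fun G => dot (S G x h) h).
  by move=> l G G'; rewrite lS cfunD cfunZ; exact: form_linear.
apply: le_trans (positive_functional_bound (cunit_cont_idb X H) lw _ F) _.
  by move=> G /pos_fun_cpositive/(order_automorphism_pos _ oS)/(_ x h).
rewrite -!mulrA ler_wpM2l // ler_wpM2l //.
apply: le_trans (pos_bound h _) _.
  by apply: (order_automorphism_pos _ oS).2; exact: pos_cont_idb.
by rewrite ler_wpM2r ?dot_ge0 // contnorm_ub.
Qed.

Lemma form_fun_subproof F (e : H) : continuous (fun x => dot (F x e) e : R[i]).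
Proof.
move=> x; apply/cvgrPdist_lt => d d0.
have n0 : 0 < dot e e + 1 by rewrite ltr_wpDl ?dot_ge0.
have /cvgrPdist_lt/(_ _ (divr_gt0 d0 n0)) := @cont_continuous _ _ _ F x.
apply: filterS => y; rewrite -hdotNl -hdotDl -bopNE -bopDE => Fxy.
apply: le_lt_trans (hdot_CS _ _) _.
apply: (@le_lt_trans _ _ (`|F x - F y| * dot e e)).
  by rewrite -hdot_norm expr2 mulrA ler_wpM2r // bopnorm_ub.
apply: (@le_lt_trans _ _ (`|F x - F y| * (dot e e + 1))).
  by rewrite ler_wpM2l // lerDl.
by rewrite -ltr_pdivlMr.
Qed.

Definition form_fun F (e : H) : CX := mkcont (@form_fun_subproof F e).

Variable e : H.
Hypothesis ee : dot e e = 1.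

Lemma cscale_inj f g : cscale f cont_idb = cscale g cont_idb -> f = g.
Proof.
move=> fg; apply: contP => x.
have := congr1 (fun F : CXB => dot (F x e) e) fg.
by rewrite !mkcontE !bopZE !hdotZl ee !mulr1.
Qed.

(* [D F = S (f * S^-1 F)] satisfies [0 <= D F <= `|f| F] for [F >= 0], so it
   multiplies each value [F x] by a scalar. *)
Lemma center_positive (S T : CXB -> CXB) f : order_automorphisms S ->
  cancel S T -> cancel T S -> (forall x, 0 <= f x) -> forall G,
  S (cscale f G) = cscale (form_fun (S (cscale f (T cont_idb))) e) (S G).
Proof.
move=> oS ST TS f0; have [lS _ _] := oS.
have oT := order_automorphisms_inv oS ST TS; have [lT _ _] := oT.
have pS F : pos_fun F -> pos_fun (S F) by move/(order_automorphism_pos _ oS).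
have pT F : pos_fun F -> pos_fun (T F) by move/(order_automorphism_pos _ oT).
pose D F := S (cscale f (T F)).
have lD : linear D by move=> l F G; rewrite /D lT cscale_linear lS.
have pD F : pos_fun F -> pos_fun (D F) by move=> pF; exact/pS/pos_cscale/pT.
have fle x : f x <= `|f| by rewrite -[leLHS]ger0_norm // contnorm_ub.
have leD F : pos_fun F -> pos_fun (`|f| *: F - D F).
  move=> pF; rewrite -[X in _ *: X]TS -(linearZ_of lS) -(linearB_of lS).
  apply: pS => x v; rewrite cfunB cfunZ mkcontE.
  rewrite bopDE bopNE !bopZE hdotDl hdotNl !hdotZl -mulrBl.
  by rewrite mulr_ge0 ?subr_ge0 // pT.
suff DE F : D F = cscale (form_fun (D cont_idb) e) F by move=> G; rewrite -DE /D ST.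
apply: contP => x; rewrite mkcontE mkcontE.
(* Since [D (g 1) <= |f| g 1], it vanishes at [x] with [g]; hence [D F x] depends on [F x] only. *)
have D0 g : (forall z, 0 <= g z) -> g x = 0 -> D (cscale g cont_idb) x = 0.
  move=> g0 gx.
  have pg : pos_fun (cscale g cont_idb) by apply: pos_cscale (@pos_cont_idb _ _ _).
  apply: form_inj => v; rewrite bop0E dot0l; apply/le_anti; rewrite (pD _ pg) andbT.
  have := leD _ pg x v; rewrite cfunB cfunZ mkcontE gx scale0r scaler0 sub0r.
  by rewrite bopNE hdotNl oppr_ge0.
rewrite (positive_map_fiber lD pD D0).
apply: (@order_bounded_scalar _ _ (fun A => D (cconst X A) x) `|f| _ _ e ee).
  by move=> l A B; rewrite cconst_linear lD.
move=> A pA; split; first by apply: pD; exact: pos_cconst.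
exact: (leD _ (pos_cconst pA) x).
Qed.

(** [Th f] is read off at [e] from [S (f S^-1 1)]. The formula extends linearly from [f >= 0], and
    the same construction for the inverse of [S] inverts [Th]. *)
Lemma center_multiplier (S : CXB -> CXB) : order_automorphisms S ->
  exists2 Th : CX -> CX, order_automorphisms Th &
  forall f G, S (cscale f G) = cscale (Th f) (S G).
Proof.
move=> oS.
have [T [ST TS]] : exists T : CXB -> CXB, cancel S T /\ cancel T S.
  by have [_ [T ST TS] _] := oS; exists T.
have oT := order_automorphisms_inv oS ST TS.
pose Th (S T : CXB -> CXB) f := form_fun (S (cscale f (T cont_idb))) e.
have key (S' T' : CXB -> CXB) : order_automorphisms S' -> cancel S' T' -> cancel T' S' ->
  [/\ linear (Th S' T'), forall f, (forall x, 0 <= f x) -> forall x, 0 <= Th S' T' f x &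
   forall f G, S' (cscale f G) = cscale (Th S' T' f) (S' G)].
  move=> oS' ST' TS'; have [lS' _ _] := oS'.
  have lTh : linear (Th S' T').
    move=> l f g; apply: contP => x; rewrite cfunD cfunZ !mkcontE.
    by rewrite cscale_linear_l lS' cfunD cfunZ; exact: form_linear.
  have oT' := order_automorphisms_inv oS' ST' TS'.
  split=> //.
    move=> f f0 x; rewrite mkcontE.
    apply: (order_automorphism_pos _ oS').2; apply: pos_cscale => //.
    by apply: (order_automorphism_pos _ oT').2; exact: pos_cont_idb.
  move=> f G; move: f; apply: (@linear_cpositive_ext _ _ _ _ (fun f => S' (cscale f G))
    (fun f => cscale (Th S' T' f) (S' G)) (cunit_cont1 R X)).
  - by move=> l f g; rewrite cscale_linear_l lS'.
  - by move=> l f g; rewrite lTh cscale_linear_l.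
  by move=> f /cpositive_fun f0; exact: (center_positive oS' ST' TS').
have [lTh pTh mS] := key _ _ oS ST TS.
have [_ pTh' mT] := key _ _ oT TS ST.
have c1 : cancel (Th S T) (Th T S).
  move=> f; apply: cscale_inj; have := mT (Th S T f) (S cont_idb).
  by rewrite -mS !ST.
have c2 : cancel (Th T S) (Th S T).
  move=> f; apply: cscale_inj; have := mS (Th T S f) (T cont_idb).
  by rewrite -mT !TS.
exists (Th S T) => //; split=> //; first by exists (Th T S).
move=> f; rewrite !cpositive_fun; split=> [/pTh'|]; last exact: pTh.
by rewrite c1.
Qed.

Lemma center_homeo (S : CXB -> CXB) : order_automorphisms S ->
  exists p q : X -> X, [/\ cancel p q, cancel q p, continuous q &
  forall f G x, S (cscale f G) x = f (p x) *: S G x].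
Proof.
move=> oS; have [Th oTh mS] := center_multiplier oS.
have [_ [T _ TS] _] := oS.
have Th1 : Th cont1 = cont1.
  apply: cscale_inj; have := mS cont1 (T cont_idb); rewrite TS => <-.
  have sc G : cscale cont1 G = G by apply: contP => x; rewrite mkcontE cont1E scale1r.
  by rewrite !sc TS.
have [p [q [pq qp _ cq ThE]]] := unital_order_auto_homeo oTh Th1.
by exists p, q; split=> // f G x; rewrite mS mkcontE ThE.
Qed.

(** [S F x] depends only on [F (p x)], and [T F (p x)] only on [F x], so the two fibre maps are
    inverse to each other. *)
Lemma order_automorphism_fiber (S : CXB -> CXB) x : order_automorphisms S ->
  order_auto (fun A => S (cconst X A) x).
Proof.
move=> oS; have [lS _ _] := oS.
have [T [ST TS]] : exists T : CXB -> CXB, cancel S T /\ cancel T S.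
  by have [_ [T ST TS] _] := oS; exists T.
have oT := order_automorphisms_inv oS ST TS; have [lT _ _] := oT.
have [p [q [pq qp cq mS]]] := center_homeo oS.
have pS F : pos_fun F -> pos_fun (S F) by move/(order_automorphism_pos _ oS).
have pT F : pos_fun F -> pos_fun (T F) by move/(order_automorphism_pos _ oT).
have fS F : S F x = S (cconst X (F (p x))) x.
  by apply: (positive_map_fiber lS pS) => f _ f0; rewrite mS f0 scale0r.
have fT F : T F (p x) = T (cconst X (F x)) (p x).
  apply: (positive_map_fiber lT pT) => f _ f0.
  have cfq : continuous (fun y => f (q y)).
    by move=> y; apply: continuous_comp; [exact: cq | exact: cont_continuous].
  have -> : cscale f cont_idb = S (cscale (mkcont cfq) (T cont_idb)).
    by apply: contP => y; rewrite mS TS !mkcontE pq.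
  by rewrite ST !mkcontE pq f0 scale0r.
have PQ : cancel (fun A => S (cconst X A) x) (fun A => T (cconst X A) (p x)).
  by move=> A /=; rewrite -fT ST.
split.
- by move=> l A B; rewrite cconst_linear lS.
- by exists (fun A => T (cconst X A) (p x)) => // A /=; rewrite -fS TS.
- move=> A; split=> [pA|pA]; last exact: pS (pos_cconst pA) x.
  by rewrite -[A]PQ; exact: pT (pos_cconst pA) (p x).
Qed.

End Center.

(** * Unital maps of [C(X, B(H))] that are locally order automorphisms *)

Section LocalAutomorphisms.
Variables (R : realType) (X : compactHausdorffType) (H : hilbertType R).
Local Notation dot := (@hdot R H).
Local Notation BH := (boundedop H).
Local Notation CX := (cont_space X R[i]).
Local Notation CXB := (cont_space X BH).
Local Notation cont1 := (cont1 R X).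
Local Notation cont_idb := (cont_idb X H).
Implicit Types (f g : CX) (F G : CXB) (A B : BH) (x y : X) (l m : R[i]).

Variable e : H.
Hypothesis ee : dot e e = 1.

(** [order_auto_unit] for the inverse of the fibre map bounds [S 1 x] below by a positive multiple
    of the identity. *)
Lemma order_automorphism_unit_gt0 (S : CXB -> CXB) x : order_automorphisms S ->
  0 < dot (S cont_idb x e) e.
Proof.
move=> /(order_automorphism_fiber ee x) oP.
have [_ [Q PQ QP] _] := oP; have oQ := order_auto_inv oP PQ QP.
have [|m m0 /(_ e)] := @order_auto_unit _ _ Q (S cont_idb x) 1 oQ ltr01.
  by rewrite (PQ (idb H)) scale1r subrr => v; rewrite bop0E dot0l.
rewrite bopDE bopNE bopZE hdotDl hdotNl hdotZl ee mulr1 subr_ge0.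
exact: lt_le_trans.
Qed.

Lemma scaled_order_automorphism (Th : CX -> CX) (q : CX) : order_automorphisms Th ->
  (forall x, 0 < q x) -> order_automorphisms (fun f => cscale q (Th f)).
Proof.
move=> oT q0; have [lT [Ti TK KT] pT] := oT.
have qN0 x : q x != 0 by rewrite gt_eqF.
have qK (f : CX) : cscale q (cscale (cinv qN0) f) = f.
  by apply: contP => x; rewrite !mkcontE scalerA divff // scale1r.
have Kq (f : CX) : cscale (cinv qN0) (cscale q f) = f.
  by apply: contP => x; rewrite !mkcontE scalerA mulVf // scale1r.
split.
- move=> l f g; rewrite lT; apply: contP => x.
  suff : q x * (l * Th f x + Th g x) = l * (q x * Th f x) + q x * Th g x by [].
  by ring.
- exists (fun f => Ti (cscale (cinv qN0) f)) => f; first by rewrite Kq TK.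
  by rewrite KT qK.
- have qE (f : CX) x : (0 <= cscale q f x) <-> (0 <= f x).
    by rewrite cscale_mulE pmulr_rge0.
  by move=> f; rewrite -(pT f) !cpositive_fun; split=> fx x; apply/qE.
Qed.

Section UnitalLocal.
Variable T : CXB -> CXB.
Hypothesis bT : bounded_linear T.
Hypothesis T1 : T cont_idb = cont_idb.
Hypothesis locT : forall F, exists2 S : CXB -> CXB, order_automorphisms S & T F = S F.

Let lT : linear T. Proof. by case: bT. Qed.

Let pT F : pos_fun F -> pos_fun (T F).
Proof. by have [S oS ->] := locT F => /(order_automorphism_pos _ oS). Qed.

Definition center_trace f : CX := form_fun (T (cscale f cont_idb)) e.

(* [T ((f - c) 1)] is at [x] a scalar multiple of an invertible positive
   operator, and its form vanishes at [e] for [c = center_trace f x]. *)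
Lemma center_traceE f x : T (cscale f cont_idb) x = center_trace f x *: idb H.
Proof.
set c := center_trace f x; pose g := f - c *: cont1.
have gE : T (cscale g cont_idb) x = T (cscale f cont_idb) x - c *: idb H.
  have -> : cscale g cont_idb = cscale f cont_idb - c *: cont_idb.
    apply: contP => y; rewrite cfunB cfunZ !mkcontE -scalerBl.
    by congr (_ *: _); exact: sub_cont1E.
  by rewrite (linearB_of lT) (linearZ_of lT) T1 cfunB cfunZ.
have [S oS SE] := locT (cscale g cont_idb).
have [Th _ mS] := center_multiplier ee oS.
have TgE : T (cscale g cont_idb) x = Th g x *: S cont_idb x by rewrite SE mS mkcontE.
have : dot (T (cscale g cont_idb) x e) e = 0.
  rewrite gE bopDE bopNE bopZE hdotDl hdotNl hdotZl ee mulr1.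
  by rewrite /c mkcontE subrr.
rewrite TgE bopZE hdotZl => /eqP; rewrite mulf_eq0.
rewrite (gt_eqF (order_automorphism_unit_gt0 x oS)) orbF => /eqP Th0.
by apply/subr0_eq; rewrite -gE TgE Th0 scale0r.
Qed.

(** At a given [f], [T (f 1) = S (f 1) = Th f * S 1], so the value there is that of [Th] scaled by
    the positive function [<S 1 e, e>]. *)
Lemma center_trace_ref_al : ref_al (@order_automorphisms R CX) center_trace.
Proof.
split.
  split.
    move=> l f g; apply: contP => x; rewrite cfunD cfunZ !mkcontE.
    by rewrite cscale_linear_l lT cfunD cfunZ; exact: form_linear.
  have [M M0 TM] := bop_bound (BoundedOp bT); exists M => f.
  apply: contnorm_le => [|x]; first exact: mulr_ge0.
  have e1 : `|e| = 1.
    by apply/eqP; rewrite -(@eqrXn2 _ 2) // hdot_norm ee expr1n.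
  rewrite mkcontE (le_trans (hdot_CS _ _)) // e1 mulr1.
  rewrite (le_trans (bopnorm_ub _ _)) // e1 mulr1 (le_trans (contnorm_ub _ _)) //.
  have fc : `|cscale f cont_idb| <= `|f|.
    apply: contnorm_le => // y; rewrite !mkcontE normrZ.
    have [_ _ _ i1] := cunit_idb H.
    by rewrite -[leRHS]mulr1 ler_pM // contnorm_ub.
  by apply: le_trans (TM _) _; rewrite ler_wpM2l.
move=> f; have [S oS SE] := locT (cscale f cont_idb).
have [Th oTh mS] := center_multiplier ee oS.
exists (fun g => cscale (form_fun (S cont_idb) e) (Th g)).
  by apply: scaled_order_automorphism => // x; rewrite mkcontE order_automorphism_unit_gt0.
apply: contP => x; rewrite !mkcontE SE mS mkcontE bopZE hdotZl.
exact: mulrC.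
Qed.

Lemma unital_local_surj : separable_space H -> order_automorphisms center_trace ->
  forall G, exists F, T F = G.
Proof.
move=> sepH oTr G.
have Tr1 : center_trace cont1 = cont1.
  apply: contP => x; rewrite mkcontE.
  have -> : cscale cont1 cont_idb = cont_idb.
    by apply: contP => y; rewrite mkcontE cont1E scale1r.
  by rewrite T1 !mkcontE.
have [p [q [pq qp cp cq pE]]] := unital_order_auto_homeo oTr Tr1.
have fT F x : T F x = T (cconst X (F (p x))) x.
  by apply: (positive_map_fiber lT pT) => f _ f0; rewrite center_traceE pE f0 scale0r.
pose E x A := T (cconst X A) x.
have lE x : locally_order_auto (E x).
  split; first by move=> l A B; rewrite /E cconst_linear lT.
    by rewrite /E T1.
  move=> A; have [S oS SE] := locT (cconst X A).
  exists (fun B => S (cconst X B) x); last by rewrite /E SE.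
  exact: (order_automorphism_fiber ee).
have e0 : e != 0 by rewrite -dot_eq0 ee oner_eq0.
have Eb x := locally_order_auto_bij sepH e0 (lE x).
have Es y : exists A, E (q y) A = G (q y) by have [] := Eb (q y).
pose F y := projT1 (cid (Es y)).
have FE y : E (q y) (F y) = G (q y) by rewrite /F; case: cid.
have cF : continuous F.
  move=> y; apply/cvgrPdist_lt => d d0.
  have d20 : 0 < d / 2 by rewrite divr_gt0.
  (* [K z] is the image of [F z - F y] under [E (q z)]. The inverses of these fibre maps have the
     common bound 2, and [K] is continuous with [K y = 0]. *)
  pose K z := (G - T (cconst X (F y))) (q z).
  have cK : K z @[z --> y] --> K y.
    by apply: (continuous_comp (cq y)); exact: cont_continuous.
  have Ky : K y = 0 by rewrite /K -[LHS]/(G (q y) - E (q y) (F y)) FE subrr.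
  have /cvgrPdist_lt/(_ _ d20) := cK.
  apply: filterS => z; rewrite Ky sub0r normrN => Kz.
  have [_ nE] := Eb (q z).
  rewrite distrC; apply: le_lt_trans (nE _) _; have [lEz _ _] := lE (q z).
  rewrite (linearB_of lEz) FE mulrC -ltr_pdivlMr //.
exists (mkcont cF); apply: contP => x.
by rewrite fT mkcontE -[LHS]/(E x (F (p x))) -{1}(pq x) FE pq.
Qed.

End UnitalLocal.

End LocalAutomorphisms.

(** * Algebraic reflexivity, by reduction to unital maps *)

Theorem theorem2p5 (R : realType) (X : compactHausdorffType)
    (H : hilbertType R) (sepH : separable_space H) :
  algebraically_reflexive (@order_automorphisms R (cont_space X R[i])) ->
  algebraically_reflexive (@order_automorphisms R (cont_space X (boundedop H))).
Proof.
move=> refX; apply/seteqP; split=> [T [bT locT]|S oS]; last first.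
  by split=> [|F]; [exact: order_automorphism_bounded | exists S].
have loc F : exists2 S, order_automorphisms S & T F = S F.
  by have [S oS SE] := locT F; exists S.
have [lT _] := bT.
(* Injectivity follows from an automorphism agreeing with [T] at [F - G], and positivity in the same
   way. *)
suff surj G : exists F, T F = G.
  split=> //; last by move=> F; have [S [_ _ pS] ->] := loc F.
  have inj : injective T.
    move=> F G FG; apply/subr0_eq; have [S [lS bS _] SE] := loc (F - G).
    apply: (bij_inj bS); rewrite -SE (linearB_of lT) FG subrr.
    by rewrite (linear0_of lS).
  pose g G := projT1 (cid (surj G)).
  have gK G : T (g G) = G by rewrite /g; case: cid.
  by exists g => // F; apply: inj; rewrite gK.
(* For [H = 0] the algebra is zero; otherwise a unit vector [e] exists. *)
have [[h h0]|/forallNP Hz] := pselect (exists h : H, h != 0); last first.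
  exists 0; apply: contP => x; apply: bopP => v.
  have z (w : H) : w = 0 by apply/eqP; apply: contraT => w0; case: (Hz w w0).
  by rewrite [LHS]z [RHS]z.
pose e := `|h|^-1 *: h.
have ee : hdot e e = 1.
  by rewrite -hdot_norm normrZ normfV normr_id mulVf ?expr1n // normr_eq0.
have [S1 oS1 S1E] := loc (cont_idb X H).
have [lS1 [U SU US] _] := oS1; have oU := order_automorphisms_inv oS1 SU US.
have bU := order_automorphism_bounded oU; have [lU _] := bU.
pose T' F := U (T F).
have bT' : bounded_linear T'.
  split; first by move=> l F G'; rewrite /T' lT lU.
  have [M M0 UM] := bop_bound (BoundedOp bU).
  have [N _ TN] := bop_bound (BoundedOp bT).
  exists (M * N) => F; apply: le_trans (UM _) _.
  rewrite -mulrA; apply: ler_wpM2l => //; exact: TN.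
have T'1 : T' (cont_idb X H) = cont_idb X H by rewrite /T' S1E SU.
have loc' F : exists2 S, order_automorphisms S & T' F = S F.
  have [S oS SE] := loc F; exists (U \o S); first exact: order_automorphisms_comp.
  by rewrite /T' SE.
have oTr : order_automorphisms (center_trace e T').
  by rewrite -refX; exact: center_trace_ref_al.
have [F FE] := unital_local_surj ee bT' T'1 loc' sepH oTr (U G).
by exists F; apply: (can_inj US).
Qed.
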